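(* Let $H\in\mathcal C^\infty((\mathbb R^d)^*;\mathbb R)$ be such that the Hessian $d^2H(\xi)$ is definite for all $\xi$. Let $(u_h)$ be a normalised, $h$-oscillating sequence in $L^2(\mathbb T^d)$ such that each $u_h$ is an eigenfunction of $H(hD_x)$. Then every weak limit, as $h\to0^+$ (along subsequences), of the probability measures $|u_h(x)|^2dx$ on $\mathbb T^d$ is absolutely continuous with respect to the Lebesgue measure $dx$.
   Context: $\mathbb T^d=(\mathbb R/2\pi\mathbb Z)^d$, $D_x=-i\partial_x$; $H(hD_x)$ is the Fourier multiplier $e^{ik\cdot x}\mapsto H(hk)e^{ik\cdot x}$, $k\in\mathbb Z^d$. A sequence $(u_h)$, with $h$ running along a sequence tending to $0^+$, is normalised if $\|u_h\|_{L^2(\mathbb T^d)}=1$, and $h$-oscillating if $\limsup_{h\to0^+}\|\mathbf 1_{[R,+\infty[}(-h^2\Delta)u_h\|_{L^2(\mathbb T^d)}\to0$ as $R\to\infty$. *)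

(* Defs.v *)
From HB Require Import structures.
From mathcomp Require Import all_boot all_order all_algebra generic_quotient.
From mathcomp Require Import all_classical all_reals all_analysis.
From mathcomp Require Import complex.

Set Implicit Arguments.
Unset Strict Implicit.
Unset Printing Implicit Defensive.

Import Order.TTheory GRing.Theory Num.Theory.
Import numFieldNormedType.Exports.

Local Open Scope classical_set_scope.
Local Open Scope quotient_scope.
Local Open Scope ring_scope.

(* MathComp-Analysis only has binary product measures: Lebesgue measure on R^n is
   obtained by iterating lebesgue_measure \x _, transported to tuples. *)
Section cons_product.
Context {R : realType}.
Variables (n : nat)
  (l : {sigma_finite_measure set (measurableTypeR R) -> \bar R})
  (m : {sigma_finite_measure set (n.-tuple (measurableTypeR R)) -> \bar R}).

Definition cons_pair (p : measurableTypeR R * n.-tuple (measurableTypeR R)) :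
  n.+1.-tuple (measurableTypeR R) := [tuple of p.1 :: p.2].

Definition uncons (t : n.+1.-tuple (measurableTypeR R)) :
  measurableTypeR R * n.-tuple (measurableTypeR R) :=
  (thead t, [tuple of behead t]).

Lemma measurable_cons_pair : measurable_fun [set: _] cons_pair.
Proof. exact: measurable_cons. Qed.

Lemma measurable_uncons : measurable_fun [set: _] uncons.
Proof.
apply: measurable_fun_pair; first exact: measurable_tnth.
exact: measurable_behead.
Qed.

Lemma cons_pairK : cancel cons_pair uncons.
Proof.
case=> x t; rewrite /uncons /cons_pair theadE; congr pair.
by apply/val_inj.
Qed.

Definition cons_product : set (n.+1.-tuple (measurableTypeR R)) -> \bar R :=
  pushforward (l \x m)%E cons_pair.

Let cons_product0 : cons_product set0 = 0%E.
Proof. by rewrite /cons_product /pushforward preimage_set0 measure0. Qed.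

Let cons_product_ge0 A : (0 <= cons_product A)%E.
Proof. by rewrite /cons_product /pushforward measure_ge0. Qed.

Let cons_product_sigma_additive : semi_sigma_additive cons_product.
Proof.
apply: (@measure_semi_sigma_additive _ _ _ (pushforward _ _)).
exact: measurable_cons_pair.
Qed.

HB.instance Definition _ := isMeasure.Build _ _ _ cons_product
  cons_product0 cons_product_ge0 cons_product_sigma_additive.

Let cons_product_sigma_finite : sigma_finite setT cons_product.
Proof.
have /sigma_finiteP[F [TF ndF Foo]] := sigma_finiteT l.
have /sigma_finiteP[G [TG ndG Goo]] := sigma_finiteT m.
exists (fun k => uncons @^-1` (F k `*` G k)).
  rewrite -preimage_bigcup -(preimage_setT uncons) -setXTT TF TG; congr (_ @^-1` _).
  rewrite predeqE => -[x y]; split.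
    move=> [/= [i _ Fix] [j _ Gjy]]; exists (maxn i j) => //; split.
    - by move: x Fix; exact/subsetPset/ndF/leq_maxl.
    - by move: y Gjy; exact/subsetPset/ndG/leq_maxr.
  by move=> [k _ []/= ? ?]; split; exists k.
move=> k; have [mF Fk] := Foo k; have [mG Gk] := Goo k.
have mFG : measurable (F k `*` G k) by exact: measurableX.
split.
  by rewrite -[X in measurable X]setTI; exact: measurable_uncons.
rewrite /cons_product /pushforward -comp_preimage.
rewrite (_ : uncons \o cons_pair = id); last first.
  by apply/funext => x /=; exact: cons_pairK.
by rewrite preimage_id product_measure1E// lte_mul_pinfty// ge0_fin_numE.
Qed.

HB.instance Definition _ := Measure_isSigmaFinite.Build _ _ _ cons_product
  cons_product_sigma_finite.

End cons_product.

Fixpoint lebesgue_tuple (R : realType) (n : nat) :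
    {sigma_finite_measure set (n.-tuple (measurableTypeR R)) -> \bar R} :=
  match n with
  | 0%N => \d_([tuple])
  | n'.+1 => cons_product (@lebesgue_measure R) (lebesgue_tuple R n')
  end.

(* (R / 2 pi Z)^d as the quotient of R^d, with the quotient topology and its
   Borel sigma-algebra *)
Section torus.
Context {R : realType} (d : nat).

Definition same_mod_2pi (x y : 'rV[R]_d) : bool :=
  [forall i, (x 0 i - y 0 i) / (2 * pi) \is a Num.int].

Lemma same_mod_2pi_refl : reflexive same_mod_2pi.
Proof. by move=> x; apply/forallP => i; rewrite subrr mul0r. Qed.

Lemma same_mod_2pi_sym : symmetric same_mod_2pi.
Proof.
suff imp x y : same_mod_2pi x y -> same_mod_2pi y x.
  by move=> x y; apply/idP/idP; exact: imp.
move=> /forallP xy; apply/forallP => i.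
by rewrite -opprB mulNr rpredN; exact: xy.
Qed.

Lemma same_mod_2pi_trans : transitive same_mod_2pi.
Proof.
move=> y x z /forallP xy /forallP yz; apply/forallP => i.
by rewrite -(subrKA (y 0 i)) mulrDl rpredD.
Qed.

Canonical same_mod_2pi_equiv :=
  EquivRel same_mod_2pi same_mod_2pi_refl same_mod_2pi_sym same_mod_2pi_trans.

Definition torus_quotient := quotient_topology {eq_quot same_mod_2pi_equiv}.

Definition torus := g_sigma_algebraType (@open torus_quotient).

HB.instance Definition _ := PointedTopological.copy torus torus_quotient.
HB.instance Definition _ := Quotient.copy torus torus_quotient.
HB.instance Definition _ :=
  Measurable.copy torus (g_sigma_algebraType (@open torus_quotient)).

End torus.
Arguments torus : clear implicits.

Section lebesgue_torus.
Context {R : realType} (d : nat).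
Local Notation tupleR := (d.-tuple (measurableTypeR R)).

Definition row_of_tuple (t : tupleR) : 'rV[R]_d := \row_i tnth t i.

Lemma measurable_preimage_row (O : set 'rV[R]_d) :
  open O -> measurable (row_of_tuple @^-1` O).
Proof.
move=> oO.
pose box (p : 'rV[rat]_d * 'rV[rat]_d) : set tupleR :=
  \bigcap_(i in [set: 'I_d]) ((@tnth _ _)^~ i @^-1`
    `]ratr (p.1 0 i), ratr (p.2 0 i)[%classic).
pose F p := if `[< box p `<=` row_of_tuple @^-1` O >] then box p else set0.
rewrite (_ : _ @^-1` _ = \bigcup_p F p).
  apply: countable_bigcupT_measurable; first exact: countableP.
  move=> p; rewrite /F; case: ifP => // _.
  apply: fin_bigcap_measurable; first exact: finite_finset.
  move=> i _; rewrite -[X in measurable X]setTI.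
  by apply: measurable_tnth => //; exact: measurable_itv.
apply/seteqP; split=> [t Ot|t [p _]]; last first.
  by rewrite /F; case: asboolP => // + tp; exact.
have /nbhs_ballP[e /= e0 eO] : nbhs (row_of_tuple t) O by exact: open_nbhs_nbhs.
have /choice[a ha] : forall i, exists q : rat, ratr q \in `]tnth t i - e, tnth t i[.
  by move=> i; apply: rat_in_itvoo; rewrite ltrBlDr ltrDl.
have /choice[b hb] : forall i, exists q : rat, ratr q \in `]tnth t i, tnth t i + e[.
  by move=> i; apply: rat_in_itvoo; rewrite ltrDl.
exists (\row_i a i, \row_i b i) => //.
have tab : box (\row_i a i, \row_i b i) t.
  move=> i _ /=; rewrite !mxE in_itv/=.
  by move: (ha i) (hb i); rewrite !in_itv/= => /andP[_ ->] /andP[->].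
rewrite /F; case: asboolP => // -[] s sab; apply: eO; split => // i j.
have := sab j I; rewrite /= !mxE in_itv/= => /andP[aj bj].
move: (ha j) (hb j); rewrite !in_itv/= => /andP[aj' _] /andP[_ bj'].
rewrite /ball/= ltr_distlC (lt_trans aj' aj)/=.
by rewrite (lt_trans bj bj').
Qed.

Definition torus_proj (t : tupleR) : torus R d := \pi_(torus R d) (row_of_tuple t).

Lemma measurable_torus_proj : measurable_fun [set: tupleR] torus_proj.
Proof.
apply: (@measurability _ _ _ _ _ _ (@open (torus R d))) => //.
move=> _ [U oU <-]; rewrite setTI; exact: (measurable_preimage_row oU).
Qed.

Definition fundamental_cube : set tupleR :=
  [set t | forall i, tnth t i \in `[0, 2 * pi[].

Lemma measurable_fundamental_cube : measurable fundamental_cube.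
Proof.
rewrite (_ : fundamental_cube = \bigcap_(i in [set: 'I_d])
    ((@tnth _ _)^~ i @^-1` `[0, 2 * pi[%classic)).
  apply: fin_bigcap_measurable; first exact: finite_finset.
  move=> i _; rewrite -[X in measurable X]setTI.
  by apply: measurable_tnth => //; exact: measurable_itv.
by apply/seteqP; split => t /= tP => [i _|i]; exact: tP.
Qed.

(* total mass (2 pi)^d *)
Definition lebesgue_torus : set (torus R d) -> \bar R :=
  pushforward (mrestr (lebesgue_tuple R d) measurable_fundamental_cube)
    torus_proj.

Let lebesgue_torus0 : lebesgue_torus set0 = 0%E.
Proof. by rewrite /lebesgue_torus /pushforward preimage_set0 measure0. Qed.

Let lebesgue_torus_ge0 A : (0 <= lebesgue_torus A)%E.
Proof. by rewrite /lebesgue_torus /pushforward measure_ge0. Qed.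

Let lebesgue_torus_sigma_additive : semi_sigma_additive lebesgue_torus.
Proof.
apply: (@measure_semi_sigma_additive _ _ _ (pushforward _ _)).
exact: measurable_torus_proj.
Qed.

HB.instance Definition _ := isMeasure.Build _ _ _ lebesgue_torus
  lebesgue_torus0 lebesgue_torus_ge0 lebesgue_torus_sigma_additive.

End lebesgue_torus.
Arguments lebesgue_torus : clear implicits.

Section calculus.
Context {R : realType} {d : nat}.
Implicit Types (f : 'rV[R]_d -> R) (xi v w : 'rV[R]_d).

(* C^n in the Frechet sense; by differentiability 'D_v f xi = 'd f xi v *)
Fixpoint Ck (n : nat) f : Prop :=
  match n with
  | 0%N => continuous f
  | n'.+1 => (forall xi, differentiable f xi) /\
             (forall v, Ck n' (fun xi => 'D_v f xi))
  end.

Definition smooth f := forall n, Ck n f.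

Definition hessian f xi v w : R := 'D_v (fun eta => 'D_w f eta) xi.

Definition definite_form (q : 'rV[R]_d -> 'rV[R]_d -> R) :=
  (forall v, v != 0 -> 0 < q v v) \/ (forall v, v != 0 -> q v v < 0).

End calculus.

Section torus_analysis.
Context {R : realType} {d : nat}.
Local Notation T := (torus R d).
Local Notation dx := (lebesgue_torus R d).
Implicit Types (u v : T -> R[i]) (k : 'rV[int]_d) (m : 'rV[R]_d -> R) (h : R).

Definition modulus (z : R[i]) : R := ComplexField.Normc.normc z.

Definition measurable_cfun u :=
  measurable_fun setT (fun x => complex.Re (u x)) /\
  measurable_fun setT (fun x => complex.Im (u x)).

Definition L2norm u : \bar R := Lnorm dx 2%:E (fun x => (modulus (u x))%:E).

Definition in_L2 u := measurable_cfun u /\ (L2norm u < +oo)%E.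

Definition cintegral u : R[i] :=
  ((\int[dx]_x complex.Re (u x)) +i* (\int[dx]_x complex.Im (u x)))%C.

(* the function x |-> e^{i k.x}; since k has integer entries the value does not
   depend on the chosen representative of x *)
Definition expi k (x : T) : R[i] :=
  let theta := \sum_i (k 0 i)%:~R * (repr x) 0 i in
  (cos theta +i* sin theta)%C.

Definition fourier_coef u k : R[i] :=
  ((2 * pi) ^- d)%:C%C * cintegral (fun x => u x * (expi k x)^*%C).

(* v = m(hD_x)u; in particular u lies in the L^2 domain of m(hD_x) *)
Definition fourier_multiplier m h u v :=
  [/\ in_L2 u, in_L2 v &
      forall k, fourier_coef v k =
                (m (h *: map_mx intr k))%:C%C * fourier_coef u k].

Definition eigenfunction (H : 'rV[R]_d -> R) h u :=
  L2norm u != 0%E /\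
  exists lambda : R[i], fourier_multiplier H h u (fun x => lambda * u x).

(* 1_[r, +oo[(-h^2 Delta) is m(hD_x) for m the following indicator function *)
Definition high_freq (r : R) : 'rV[R]_d -> R :=
  \1_[set xi | r <= \sum_i xi 0 i ^+ 2].

(* v r n = 1_[r, +oo[(-h_n^2 Delta) u_n is determined up to a dx-null set *)
Definition h_oscillating (h : nat -> R) (u : nat -> T -> R[i]) :=
  exists2 v : R -> nat -> T -> R[i],
    (forall r n, fourier_multiplier (high_freq r) (h n) (u n) (v r n)) &
    limn_esup (fun n => L2norm (v r n)) @[r --> +oo] --> 0%E.

(* the measures |u_n|^2 dx converge to mu against continuous functions *)
Definition weak_limit (u : nat -> T -> R[i]) (mu : {measure set T -> \bar R}) :=
  forall a : T -> R, continuous a ->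
    (\int[dx]_x (a x * modulus (u n x) ^+ 2)%:E)%E @[n --> \oo] -->
    (\int[mu]_x (a x)%:E)%E.

End torus_analysis.

(* Main.v *)
(* Let S be the set of the frequencies of an eigenfunction u with |hk| <= r. For
   k and y in S, Taylor's formula at order two between hk and hy shows that the
   linear form b = dH(hk)/h satisfies c|y-k|^2 <= |b(y-k)| <= C|y-k|^2, where c
   and C depend only on H and r. So bounded differences y-k in S control b on
   their span, hence also the length of all the differences that lie in this
   span. Consequently a chain of points of S with steps at most N has a diameter
   bounded in terms of N, as one sees by adding its points one at a time.

   Let t_0 >= t_1 >= ... >= 0 be trigonometric polynomials with integrals tending
   to 0. Then the integral of t_i |u|^2 tends to 0, uniformly in u, h and the
   eigenvalue, by induction on the dimension m of the affine span of the
   spectrum: if t_i has degree N and is good in dimension < m, then the N-clusters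
   of the spectrum do not interact in the integral of t_i |u|^2. Either they all
   have dimension < m, or one of them spans the whole spectrum, which therefore has
   a bounded number of points, and the integral of t_j |u|^2 is at most this number
   times the integral of t_j.

   If mu E > 0 for some Lebesgue null set E, approximating the indicator function
   of E in L^2(dx + mu) by trigonometric polynomials yields a sequence t_i for
   which the integral of t_i |u_n|^2 does not become small. *)
Require Import Defs.
From HB Require Import structures.
From mathcomp Require Import all_boot all_order all_algebra generic_quotient.
From mathcomp Require Import all_classical all_reals all_analysis.
From mathcomp Require Import complex.
From mathcomp Require Import measurable_realfun ring lra zify.

Set Implicit Arguments.
Unset Strict Implicit.
Unset Printing Implicit Defensive.

Import Order.TTheory GRing.Theory Num.Theory.
Import numFieldNormedType.Exports.

Local Open Scope classical_set_scope.
Local Open Scope ring_scope.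

(** * Clusters of lattice points *)

Section lattice_points.
Context {R : realType} {d : nat}.
Local Notation Z := 'rV[int]_d.
Implicit Types (k x y : Z) (A B D E : seq Z).

(** The form b may be as large as 1/h, so it has no uniform bound of its own; only the two-sided
    inequality survives as h tends to 0. Expanding 0 = H(hy) - H(hk) to order two and dividing by
    h^2 leaves no power of h, and definiteness, of either sign, keeps the quadratic term away from
    0. Integrality makes the bounds on spans uniform: only finitely many sets of lattice vectors
    have length at most N, so a single constant serves all spectra. One polynomial t would not do.
    The number of points of a spectrum spanned by one cluster depends on the degree N of t, so the
    integral has to be made small after N is known. Moving on to a later t_j achieves this, and t_j
    <= t_i keeps what was gained in lower dimension: hence a decreasing sequence and one change of
    index per dimension. A finite degree is what makes distant clusters decouple exactly. The
    functions built from E are only uniform limits of polynomials, so they are replaced by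
    polynomial majorants before clusters are considered. *)

Definition int_row (k : Z) : 'rV[R]_d := map_mx intr k.

Lemma int_rowB x y : int_row (x - y) = int_row x - int_row y.
Proof. by apply/rowP => i; rewrite !mxE rmorphB. Qed.

Lemma le_mx_norm_entry (v : 'rV[R]_d) i : `|v 0 i| <= `|v|.
Proof.
rewrite [leRHS]mx_normrE.
exact: (le_bigmax _ (fun ij : 'I_1 * 'I_d => `|v ij.1 ij.2|) (0, i)).
Qed.

Lemma mx_norm_row_le (v : 'rV[R]_d) (B : R) :
  0 <= B -> (forall i, `|v 0 i| <= B) -> `|v| <= B.
Proof.
move=> B0 vB; rewrite [leLHS]mx_normrE; apply/bigmax_leP; split => //.
by case=> i j _ /=; rewrite ord1.
Qed.

(** The coordinates of v in the generating family are linear in v, hence at most a multiple of |v|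
    that depends on [X] alone and not on [b]. *)
Lemma span_bound (X : seq 'rV[R]_d) : exists2 K : R, 0 <= K &
  forall (b : 'cV[R]_d) (B : R), 0 <= B ->
    (forall e, e \in X -> `|(e *m b) 0 0| <= B) ->
  forall v, v \in <<X>>%VS -> `|(v *m b) 0 0| <= K * B * `|v|.
Proof.
pose c i j := `|coord (in_tuple X) i (delta_mx 0 j)|.
exists (\sum_i \sum_j c i j); first by do 2!apply: sumr_ge0 => ? _; rewrite normr_ge0.
move=> b B B0 Xb v vX; rewrite {1}(coord_span (X := in_tuple X) vX).
rewrite mulmx_suml summxE (le_trans (ler_norm_sum _ _ _))//.
rewrite mulr_suml mulr_suml; apply: ler_sum => i _.
rewrite -scalemxAl mxE normrM mulrAC; apply: ler_pM => //; last first.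
  by by apply: Xb; exact: mem_nth.
rewrite {1}(row_sum_delta v) linear_sum/= (le_trans (ler_norm_sum _ _ _))//.
rewrite mulr_suml; apply: ler_sum => j _.
by rewrite linearZ/= normrM mulrC ler_wpM2l// le_mx_norm_entry.
Qed.

Lemma finite_lattice_ball (M : nat) : exists2 P : seq Z,
  uniq P & forall k, `|int_row k| <= M%:R -> k \in P.
Proof.
pose g (f : {ffun 'I_d -> 'I_(M + M).+1}) : Z := \row_j ((f j)%:Z - M%:Z).
exists (undup [seq g f | f : {ffun 'I_d -> 'I_(M + M).+1}]); first exact: undup_uniq.
move=> k kM; rewrite mem_undup; apply/mapP.
have kj j : `|k 0 j| <= M%:Z.
  have := le_trans (le_mx_norm_entry (int_row k) j) kM.
  by rewrite mxE -intr_norm -[M%:R]/(M%:Z%:~R) ler_int.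
exists [ffun j => inord (absz (k 0 j + M%:Z))]; first by rewrite mem_enum.
apply/rowP => j; rewrite mxE ffunE inordK.
  by have := kj j; move: (k 0 j) => z; rewrite ler_norml => /andP[? ?];
   rewrite gez0_abs ?addrK// -lerBlDr sub0r.
by have := kj j; lia.
Qed.

(** The vectors of [E] lie in a finite lattice ball, so only finitely many spans occur, and the sum
    of their constants serves for all of them. *)
Lemma span_bound_ball (M : nat) : exists2 K : R, 0 <= K &
  forall E, (forall e, e \in E -> `|int_row e| <= M%:R) ->
  forall (b : 'cV[R]_d) (B : R), 0 <= B ->
    (forall e, e \in E -> `|(int_row e *m b) 0 0| <= B) ->
  forall v, v \in <<map int_row E>>%VS -> `|(v *m b) 0 0| <= K * B * `|v|.
Proof.
have [P _ PM] := finite_lattice_ball M.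
have /choice[K K_] : forall X : seq 'rV[R]_d, exists K : R, 0 <= K /\
  forall (b : 'cV[R]_d) (B : R), 0 <= B ->
    (forall e, e \in X -> `|(e *m b) 0 0| <= B) ->
  forall v, v \in <<X>>%VS -> `|(v *m b) 0 0| <= K * B * `|v|.
  by move=> X; have [K] := span_bound X; exists K.
pose L (m : (size P).-tuple bool) := K (map int_row (mask m P)).
have L0 m : 0 <= L m by have [] := K_ (map int_row (mask m P)).
exists (\sum_m L m); first exact: sumr_ge0.
move=> E EM b B B0 Eb v vE.
pose m : (size P).-tuple bool := [tuple of map (mem E) (in_tuple P)].
have EmP : mask m P =i E.
  move=> e; rewrite -filter_mask mem_filter /=.
  by have [eE|//] := boolP (e \in E); rewrite PM// EM.
apply: le_trans (_ : L m * B * `|v| <= _); last first.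
  do 2!apply: ler_wpM2r => //; rewrite (bigD1 m)//= lerDl; exact: sumr_ge0.
apply: (K_ (map int_row (mask m P))).2 => //.
  by move=> _ /mapP[e + ->]; rewrite EmP; exact: Eb.
by rewrite (eq_span (eq_mem_map _ EmP)).
Qed.

(* Taylor's formula at order two gives this for the lattice points of a bounded
   piece of a level set of H(h .), with [b = dH(hk)/h]. *)
Definition pinched (c C : R) (S : set Z) := forall k, S k ->
  exists b : 'cV[R]_d, forall x, S x ->
    c * `|int_row (x - k)| ^+ 2 <= `|(int_row (x - k) *m b) 0 0|
      <= C * `|int_row (x - k)| ^+ 2.

(** The direction of the affine span of k and the points of [E]; for k in [E] it does not depend on
    the base point. *)
Definition dirs k E : {vspace 'rV[R]_d} :=
  <<[seq int_row (x - k) | x <- E]>>%VS.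

Lemma mem_dirs k E x : x \in E -> int_row (x - k) \in dirs k E.
Proof. by move=> xE; apply/memv_span/map_f. Qed.

Lemma dirs_subP k E (U : {vspace 'rV[R]_d}) :
  reflect (forall x, x \in E -> int_row (x - k) \in U) (dirs k E <= U)%VS.
Proof.
apply: (iffP span_subvP) => [EU x xE|EU _ /mapP[x xE ->]]; last exact: EU.
by apply: EU; exact: map_f.
Qed.

Lemma dirs_sub k E D : {subset E <= D} -> (dirs k E <= dirs k D)%VS.
Proof. by move=> ED; apply/dirs_subP => x /ED; exact: mem_dirs. Qed.

(** With n = |x - k|, pinching from below is quadratic while b is linear on the span: c n^2 <= |b(x
    - k)| <= K (C M^2) n, so n <= K C M^2 / c. The bound does not involve b, which may change with
    [S] and k. *)
Lemma pinched_span_bound (c C : R) : 0 < c -> 0 <= C ->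
  forall M : nat, exists M' : nat, forall S, pinched c C S ->
  forall k E x, S k -> [set` E] `<=` S ->
    (forall e, e \in E -> `|int_row (e - k)| <= M%:R) ->
    S x -> int_row (x - k) \in dirs k E -> `|int_row (x - k)| <= M'%:R.
Proof.
move=> c0 C0 M; have [K K0 KM] := span_bound_ball M.
have [M' M'P] : exists M' : nat, K * (C * M%:R ^+ 2) / c <= M'%:R.
  exists (Num.truncn (K * (C * M%:R ^+ 2) / c)).+1; rewrite ltW// truncnS_gt//.
exists M' => S pS k E x Sk ES EM Sx xE; apply: le_trans M'P.
have [b bS] := pS k Sk; have /andP[bx _] := bS x Sx.
rewrite /dirs map_comp in xE.
have := KM [seq e - k | e <- E] _ b (C * M%:R ^+ 2) _ _ _ xE.
set n := `|int_row (x - k)| in bx *.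
have n0 : 0 <= n by exact: normr_ge0.
move=> /(_ _ _ _)/le_trans-/(_ _)-H.
have : c * n ^+ 2 <= K * (C * M%:R ^+ 2) * n.
  apply: (le_trans bx); apply: H => //.
  - by move=> _ /mapP[e eE ->]; exact: EM.
  - by rewrite mulr_ge0// exprn_ge0.
  - move=> _ /mapP[e eE ->]; have /andP[_ be] := bS e (ES _ eE).
    by apply: (le_trans be); rewrite ler_wpM2l// lerXn2r ?nnegrE ?EM.
rewrite ler_pdivlMr//; move: n0; rewrite le_eqVlt => /orP[/eqP <- _|n0].
  by rewrite mul0r mulr_ge0// mulr_ge0// exprn_ge0.
by rewrite [n ^+ 2]expr2 [c * _]mulrA ler_pM2r// [n * c]mulrC.
Qed.

(** A connected set of the graph joining points at distance at most [N], listed from the newest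
    point down to the root, so that induction adds one point at a time. *)
Inductive linked (N : nat) k : seq Z -> Prop :=
| linked1 : linked N k [:: k]
| linkedS y x D : linked N k D -> x \in D -> `|int_row (y - x)| <= N%:R ->
    linked N k (y :: D).

Lemma linked_root N k D : linked N k D -> k \in D.
Proof.
by elim=> [|y x D' _ kD _ _]; [exact: mem_head|rewrite inE kD orbT].
Qed.

(* Reading D in the order in which it was built, its diameter can only grow when
   its dimension does. *)
Lemma linked_spanning (c C : R) (N : nat) : 0 < c -> 0 <= C ->
  exists T : nat -> nat, forall S, pinched c C S ->
  forall k D, linked N k D -> [set` D] `<=` S -> exists E,
    [/\ {subset E <= D}, dirs k E = dirs k D &
        forall e, e \in E -> `|int_row (e - k)| <= (T (\dim (dirs k D)))%:R].
Proof.
move=> c0 C0; have /choice[s sP] := pinched_span_bound c0 C0.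
(* When the dimension rises above m, the earlier points are within [s (T m)] of the root by
   pinching, and the new point is within [N] of one of them. *)
pose T := fix T m := if m is m'.+1 then (s (T m') + N)%N else 0%N.
exists T => S pS k D; elim=> [|y x D' lD' IH xD yx] DS.
  exists [:: k]; split => // e; rewrite inE => /eqP ->.
  rewrite subrr (_ : int_row 0 = 0) ?normr0//.
  by apply/rowP => i; rewrite !mxE.
have DS' : [set` D'] `<=` S by move=> z zD; apply: DS => /=; rewrite inE zD orbT.
have [E [ED Edirs EM]] := IH DS'.
have sD : (dirs k D' <= dirs k (y :: D'))%VS.
  by apply: dirs_sub => z zD; rewrite inE zD orbT.
have [le_dim|lt_dim] := leqP (\dim (dirs k (y :: D'))) (\dim (dirs k D')).
  have /eqP dD : dirs k D' == dirs k (y :: D') by rewrite eqEdim sD.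
  exists E; split; first by move=> z /ED zD; rewrite inE zD orbT.
    by rewrite Edirs.
  by move=> e /EM; rewrite dD.
(* The new point leaves the affine span, so the dimension grows by exactly one and the whole list
   becomes the spanning set. *)
exists (y :: D'); split => //.
have -> : \dim (dirs k (y :: D')) = (\dim (dirs k D')).+1.
  apply/eqP; rewrite eqn_leq lt_dim andbT /dirs /= span_cons.
  rewrite (leq_trans (leq_of_leqif (dimv_add_leqif _ _)))//;
   by rewrite dim_vline; case: (_ != 0)%R; rewrite ?add1n ?add0n//= leqnSn.
have bD' z : z \in D' -> `|int_row (z - k)| <= (s (T (\dim (dirs k D'))))%:R.
  move=> zD; apply: (sP _ S pS k E) => //.
  - by apply: DS'; exact: linked_root lD'.
  - by move=> e /ED; exact: DS'.
  - exact: DS'.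
  - by rewrite Edirs mem_dirs.
move=> e; rewrite inE natrD => /predU1P[->|/bD' eD]; last first.
  by rewrite (le_trans eD)// lerDl.
rewrite (_ : y - k = (y - x) + (x - k)); last by rewrite addrA subrK.
rewrite addrC (_ : int_row _ = int_row (x - k) + int_row (y - x)); last first.
  by rewrite !int_rowB; apply/rowP => i; rewrite !mxE !rmorphD/= !rmorphN.
by rewrite (le_trans (ler_normD _ _))// lerD// bD'.
Qed.

Definition far_apart (N : nat) A B :=
  forall x y : Z, x \in A -> y \in B -> N%:R < `|int_row (y - x)|.

(** Enlarge the list by any point of [A] at distance at most [N] from it. This stops because [A] is
    finite, and a list that can no longer grow is far from the rest. *)
Lemma cluster_exists N k A : uniq A -> k \in A -> exists D,
  [/\ linked N k D, uniq D, {subset D <= A} &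
      far_apart N D [seq y <- A | y \notin D]].
Proof.
move=> uA kA.
suff H n : forall D, linked N k D -> uniq D -> {subset D <= A} ->
    (size A - size D <= n)%N -> exists D,
  [/\ linked N k D, uniq D, {subset D <= A} &
      far_apart N D [seq y <- A | y \notin D]].
  apply: (H (size A) [:: k]) => //; [exact: linked1| |exact: leq_subr].
  by move=> z; rewrite inE => /eqP ->.
elim: n => [|n IH] D lD uD DA sz.
  exists D; split => // x y xD; rewrite mem_filter => /andP[yD yA].
  have : (size (y :: D) <= size A)%N.
    apply: uniq_leq_size => /=; first by rewrite yD.
    by move=> z; rewrite inE => /predU1P[->|/DA].
  by rewrite /= => /(leq_ltn_trans _)-/(_ (size D)); lia.
have [sep|] := pselect (far_apart N D [seq y <- A | y \notin D]); first by exists D.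
move=> /existsNP[x /existsNP[y /not_implyP[xD /not_implyP[+ /negP]]]].
rewrite mem_filter -leNgt => /andP[yD yA] yx.
apply: (IH (y :: D)); first exact: linkedS lD xD yx.
- by rewrite /= yD.
- by move=> z; rewrite inE => /predU1P[->|/DA].
- by rewrite /=; lia.
Qed.

Lemma dirs_root k k' A : k \in A -> k' \in A -> (dirs k A <= dirs k' A)%VS.
Proof.
move=> kA k'A; apply/dirs_subP => x xA.
have -> : x - k = (x - k') - (k - k') by rewrite opprB addrA subrK.
by rewrite int_rowB rpredB ?mem_dirs.
Qed.

(** * Decreasing families of forms that decouple over distant clusters *)

Section quadratic_forms.
(** [F i c A] stands for the integral of t_i times the squared modulus of the sum over [A] of c_k
    e^{ik.x}, [w c k] for |c_k|^2 and [delta i] for the integral of t_i. In [F_sep] the length [N]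
    exceeds the degree of t_i. *)
Variables (X : Type) (w : X -> Z -> R) (F : nat -> X -> seq Z -> R).
Variable delta : nat -> R.
Hypothesis w0 : forall c k, 0 <= w c k.
Hypothesis F_decr : forall i c A, F i.+1 c A <= F i c A.
Hypothesis F_perm : forall i c A B, perm_eq A B -> F i c A = F i c B.
Hypothesis F_sep : forall i, exists N, forall c A B,
  uniq (A ++ B) -> far_apart N A B -> F i c (A ++ B) <= F i c A + F i c B.
Hypothesis F_size : forall i c A,
  F i c A <= (size A)%:R * delta i * \sum_(k <- A) w c k.
Hypothesis delta0 : delta n @[n --> \oo] --> 0.

Lemma F_mono i j c A : (i <= j)%N -> F j c A <= F i c A.
Proof.
move=> /subnKC <-; elim: (j - i)%N => [|n IH]; first by rewrite addn0.
by rewrite addnS (le_trans (F_decr _ _ _)).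
Qed.

Lemma pinched_forms_small (c C eta : R) : 0 < c -> 0 <= C -> 0 < eta ->
  exists i, forall S, pinched c C S -> forall A (x : X), uniq A -> [set` A] `<=` S ->
    F i x A <= eta * \sum_(k <- A) w x k.
Proof.
move=> c0 C0 eta0.
have F_nil i (x : X) : F i x [::] <= eta * \sum_(k <- [::]) w x k.
  by have := F_size i x [::]; rewrite /= !mul0r big_nil mulr0.
suff H m : exists i, forall S, pinched c C S -> forall A (x : X) k, uniq A ->
    [set` A] `<=` S -> k \in A -> (\dim (dirs k A) < m)%N ->
    F i x A <= eta * \sum_(k <- A) w x k.
  have [i iP] := H d.+1; exists i => S pS [//|k A] x uA AS.
  apply: (iP S pS _ _ k) => //; first exact: mem_head.
  by rewrite ltnS (leq_trans (dimvS (subvf _)))// dimvf /dim /= mul1n.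
elim: m => [|m [i0 IH]]; first by exists 0%N.
have [N NP] := F_sep i0; have [T TP] := linked_spanning N c0 C0.
have [M MP] := pinched_span_bound c0 C0 (T m).
have [P _ PM] := finite_lattice_ball M.
(* The order of choices matters: [i0] determines [N], which determines [T], [M] and the number
   [size P] of possible points; only then is [delta i] made small against that number. *)
have [i [i0i iP]] : exists i, (i0 <= i)%N /\ (size P)%:R * `|delta i| <= eta.
  have e0 : 0 < eta / (size P).+1%:R by rewrite divr_gt0.
  have /cvgrPdist_le/(_ _ e0)[n _ nP] := delta0.
  exists (maxn i0 n); split; first exact: leq_maxl.
  have := nP (maxn i0 n) (leq_maxr _ _); rewrite /= sub0r normrN.
  rewrite ler_pdivlMr// mulrC; apply: le_trans.
  by rewrite ler_wpM2r// ler_nat.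
exists i => S pS A x k uA AS kA dimA.
have [dimD|] := pselect (forall k' D, linked N k' D -> uniq D ->
    {subset D <= A} -> (\dim (dirs k' D) < m)%N).
  (* No cluster reaches dimension [m]. Back at the index [i0], for which [N] is a separating length,
     clusters are split off one at a time; each obeys [IH] with the same [eta], so the bounds add
     up. *)
  apply: (le_trans (F_mono _ _ i0i)).
  suff G n B : (size B <= n)%N -> uniq B -> {subset B <= A} ->
      F i0 x B <= eta * \sum_(k <- B) w x k by apply: (G (size A)).
  elim: n B => [|n IHn] [|k' B]//; rewrite [size _]/= ltnS => sB uB BA.
  have [D [lD uD DB sD]] := cluster_exists N uB (mem_head k' B).
  set B' := [seq y <- k' :: B | y \notin D] in sD.
  have pB : perm_eq (k' :: B) (D ++ B').
    rewrite -(perm_filterC (mem D)) perm_cat2r; apply: uniq_perm => //.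
      exact: filter_uniq.
    by move=> z; rewrite mem_filter /=; case: (boolP (z \in D)) => // /DB ->.
  rewrite (F_perm _ _ pB) (perm_big _ pB) big_cat/= mulrDr.
  apply: (le_trans (NP _ _ _ _ sD)); first by rewrite -(perm_uniq pB).
  have DA : {subset D <= A} by move=> z /DB/BA.
  apply: lerD.
    apply: (IH S pS D x k') => //; [|exact: linked_root lD|exact: dimD].
    by move=> z /= /DA; exact: AS.
  apply: IHn; last 2 first.
  - exact: filter_uniq.
  - by move=> z; rewrite mem_filter => /andP[_ /BA].
  apply: leq_trans sB; have := perm_size pB; rewrite size_cat /=.
  by case: (D) (linked_root lD) => //= z D' _; lia.
move=> /existsNP[k' /existsNP[D /not_implyP[lD /not_implyP[uD /not_implyP[DA]]]]].
move=> /negP; rewrite -leqNgt => dimD.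
have k'A : k' \in A by apply: DA; exact: linked_root lD.
have DS : [set` D] `<=` S by move=> z /= /DA; exact: AS.
(* The direction of [A] has dimension at most [m] and contains that of [D], of dimension at least
   [m]. *)
have /eqP dDA : dirs k' D == dirs k' A.
  rewrite eqEdim dirs_sub//= (leq_trans _ dimD)//.
  by rewrite (leq_trans (dimvS (dirs_root k'A kA))).
have dimDm : \dim (dirs k' D) = m.
  apply/eqP; rewrite eqn_leq dimD andbT dDA -ltnS.
  by rewrite (leq_ltn_trans (dimvS (dirs_root k'A kA))).
have [E [ED dE ET]] := TP S pS k' D lD DS.
(* The short vectors e - k', for e in [E], span all the differences, so by pinching translation by
   k' injects [A] into the ball listed by [P]. *)
have sA : (size A <= size P)%N.
  rewrite -(size_map (fun z => z - k')); apply: uniq_leq_size.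
    by rewrite map_inj_uniq//; exact: addIr.
  move=> _ /mapP[z zA ->]; apply: PM; apply: (MP S pS k' E) => //.
  - exact: AS.
  - by move=> e /ED; exact: DS.
  - by move=> e /ET; rewrite dimDm.
  - exact: AS.
  - by rewrite dE dDA mem_dirs.
apply: (le_trans (F_size _ _ _)).
rewrite ler_wpM2r ?sumr_ge0//; apply: le_trans iP.
apply: le_trans (_ : (size A)%:R * `|delta i| <= _).
  by rewrite ler_wpM2l// ler_norm.
by rewrite ler_wpM2r// ler_nat.
Qed.

End quadratic_forms.

End lattice_points.

(** * Level sets of H *)

Section taylor.
Context {R : realType} {d : nat}.
Implicit Types (f H : 'rV[R]_d -> R) (xi v w : 'rV[R]_d).

Lemma derive_coord f xi v : differentiable f xi ->
  'D_v f xi = \sum_i v 0 i * 'D_(delta_mx 0 i) f xi.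
Proof.
move=> df; rewrite deriveE// {1}(row_sum_delta v) linear_sum/=.
by apply: eq_bigr => i _; rewrite linearZ/= deriveE.
Qed.

Lemma is_derive_line f xi w (t : R) : (forall x, differentiable f x) ->
  is_derive t 1 (fun s => f (xi + s *: w)) ('D_w f (xi + t *: w)).
Proof.
move=> df.
have E : (fun h : R => h^-1 *: (((fun s => f (xi + s *: w)) \o shift t) (h *: 1)
    - f (xi + t *: w))) =
  (fun h : R => h^-1 *: ((f \o shift (xi + t *: w)) (h *: w) - f (xi + t *: w))).
  apply/funext => h /=; rewrite /shift/=.
  by rewrite [h *: 1]mulr1 scalerDl addrCA.
have dfl : derivable f (xi + t *: w) w by exact: diff_derivable.
by split; rewrite /derivable /derive E.
Qed.

Variable H : 'rV[R]_d -> R.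
Hypothesis H_C2 : Ck 2 H.

Let dH xi : differentiable H xi. Proof. by case: H_C2. Qed.
Let ddH v xi : differentiable (fun eta => 'D_v H eta) xi.
Proof. by case: H_C2 => _ /(_ v)[]. Qed.

(** A polynomial in v with coefficients continuous in xi: joint continuity and homogeneity of degree
    two are read off from this form. *)
Lemma hessian_coord xi v : hessian H xi v v =
  \sum_i \sum_j v 0 i * v 0 j * hessian H xi (delta_mx 0 i) (delta_mx 0 j).
Proof.
rewrite /hessian derive_coord//; apply: eq_bigr => i _.
have -> : (fun eta => 'D_v H eta) =
    \sum_j (v 0 j \*: (fun eta => 'D_(delta_mx 0 j) H eta)).
  apply/funext => eta; rewrite fct_sumE derive_coord//.
rewrite derive_sum; last by move=> j; apply/derivableZ/diff_derivable.
rewrite mulr_sumr; apply: eq_bigr => j _; rewrite deriveZ ?mulrA//.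
exact: diff_derivable.
Qed.

Lemma hessian_continuous v w : continuous (fun xi => hessian H xi v w).
Proof. by case: H_C2 => _ /(_ w)[_ /(_ v)]. Qed.

Lemma taylor2 xi w : exists2 t : R, 0 <= t <= 1 &
  H (xi + w) = H xi + 'D_w H xi + hessian H (xi + t *: w) w w / 2.
Proof.
pose g t := H (xi + t *: w); pose g' t := 'D_w H (xi + t *: w).
have Dg (t : R) : is_derive t 1 g (g' t) by exact: is_derive_line.
have Dg' (t : R) : is_derive t 1 g' (hessian H (xi + t *: w) w w).
  exact: (is_derive_line xi w t (ddH w)).
(* The constant [A] is chosen so that [phi], which is g minus t g'(0) + t^2 A, has equal values at 0
   and 1. The mean value theorem for [phi] gives g'(s) - g'(0) = 2 s A, and for g' on [0, s] it
   gives g''(t) = 2 A. *)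
pose A := g 1 - g 0 - g' 0.
pose phi := g - (fun t : R => t * g' 0 + t ^+ 2 * A).
have Dphi (t : R) : is_derive t 1 phi (g' t - (g' 0 + 2 * t * A)).
  apply: is_deriveB.
  apply: is_derive_eq; rewrite /GRing.scale/= !(mulr0, addr0, mulr1, add0r, mul1r).
  by ring.
have cont (k k' : R -> R) a b : (forall t : R, is_derive t 1 k (k' t)) ->
    {within `[a, b], continuous k}.
  by move=> Dk; apply: derivable_within_continuous => t _.
have [s] := MVT ltr01 (fun t _ => Dphi t) (cont _ _ _ _ Dphi).
rewrite in_itv/= => /andP[s0 s1].
have -> : phi 1 - phi 0 = 0.
  by rewrite /phi !fctE /A; ring.
rewrite subr0 mulr1 => /esym/eqP; rewrite subr_eq0 => /eqP g's.
have [t] := MVT s0 (fun t _ => Dg' t) (cont _ _ _ _ Dg').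
rewrite in_itv/= => /andP[t0 ts]; rewrite g's subr0 => E.
exists t; first by rewrite !ltW//= (lt_trans ts).
have {}E : hessian H (xi + t *: w) w w = 2 * A.
  apply: (mulIf (lt0r_neq0 s0)); rewrite -E; ring.
rewrite E /A /g /g' !scale0r scale1r addr0.
by field.
Qed.

Hypothesis H_definite : forall xi, definite_form (hessian H xi).

(** By homogeneity v may be taken on the unit sphere. On the compact product of the ball and the
    sphere the continuous function |d^2H| has extrema, and definiteness makes the minimum
    positive. *)
Lemma hessian_bounds (r : R) : exists c C : R, [/\ 0 < c, 0 <= C &
  forall xi v, `|xi| <= r ->
    c * `|v| ^+ 2 <= `|hessian H xi v v| <= C * `|v| ^+ 2].
Proof.
pose K := [set p : 'rV[R]_d * 'rV[R]_d | `|p.1| <= r /\ `|p.2| = 1].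
pose G (p : 'rV[R]_d * 'rV[R]_d) := `|hessian H p.1 p.2 p.2|.
have G_cont : continuous G.
  move=> p; apply: (continuous_comp
    (f := fun q : 'rV[R]_d * 'rV[R]_d => hessian H q.1 q.2 q.2)
    (g := Num.norm : R -> R)); last exact: norm_continuous.
  rewrite (_ : (fun p : 'rV[R]_d * 'rV[R]_d => hessian H p.1 p.2 p.2) =
    \sum_i \sum_j (fun q : 'rV[R]_d * 'rV[R]_d => q.2 0 i * q.2 0 j *
      hessian H q.1 (delta_mx 0 i) (delta_mx 0 j))); last first.
    apply/funext => q; rewrite hessian_coord fct_sumE; apply: eq_bigr => i _.
    by rewrite fct_sumE.
  have c2 i : continuous (fun q : 'rV[R]_d * 'rV[R]_d => q.2 0 i).
    move=> q; apply: (continuous_comp (f := snd) (g := fun v : 'rV[R]_d => v 0 i)).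
      exact: cvg_snd.
    exact: coord_continuous.
  apply: (big_ind (fun f : 'rV[R]_d * 'rV[R]_d -> R => {for p, continuous f})).
  - exact: cst_continuous.
  - by move=> f g cf cg; exact: cvgD.
  move=> i _.
  apply: (big_ind (fun f : 'rV[R]_d * 'rV[R]_d -> R => {for p, continuous f})).
  - exact: cst_continuous.
  - by move=> f g cf cg; exact: cvgD.
  move=> j _; apply: cvgM; first by apply: cvgM; exact: c2.
  apply: (continuous_comp (f := fst)
    (g := fun x : 'rV[R]_d => hessian H x (delta_mx 0 i) (delta_mx 0 j))).
    exact: cvg_fst.
  exact: hessian_continuous.
have K_compact : compact K.
  rewrite (_ : K = [set x | `|x| <= r] `*` [set x | `|x| = 1]); last first.
    by apply/seteqP; split => -[].
  apply: compact_setX; apply: bounded_closed_compact.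
  - by exists r; split; [exact: num_real|move=> x rx y /= /le_trans; apply; exact: ltW].
  - rewrite (_ : mkset _ = (@Num.norm R 'rV[R]_d : 'rV[R]_d -> R) @^-1` [set x | x <= r])//.
    apply: preimage_closed; last exact: closed_le.
    by move=> x _; exact: norm_continuous.
  - by exists 1; split; [exact: num_real|move=> x rx y /= ->; exact: ltW].
  - rewrite (_ : mkset _ = (@Num.norm R 'rV[R]_d : 'rV[R]_d -> R) @^-1` [set 1])//.
    apply: preimage_closed; last exact: closed_eq.
    by move=> x _; exact: norm_continuous.
have hom xi v (t : R) : hessian H xi (t *: v) (t *: v) = t ^+ 2 * hessian H xi v v.
  rewrite !hessian_coord mulr_sumr; apply: eq_bigr => i _.
  rewrite mulr_sumr; apply: eq_bigr => j _; rewrite !mxE; ring.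
have hom0 xi : hessian H xi 0 0 = 0.
  by have := hom xi 0 0; rewrite scale0r expr0n mul0r.
have [c [C [c0 C0 cC]]] : exists c C : R, [/\ 0 < c, 0 <= C &
    forall p, K p -> c <= G p <= C].
  have [K0|] := pselect (K !=set0); last first.
    (* There is no unit vector when d = 0 and no point xi when r < 0; the bounds are then
       vacuous. *)
    move=> K0; exists 1, 0; split => // p Kp.
    by exfalso; apply: K0; exists p.
  have Gw : {within K, continuous G} by exact: continuous_subspaceT.
  have [p1 Kp1 p1P] := compact_EVT_min K0 K_compact Gw.
  have [p2 Kp2 p2P] := compact_EVT_max K0 K_compact Gw.
  exists (G p1), (G p2); split.
  - move: Kp1; rewrite inE => -[_ n1]; rewrite /G normr_gt0.
    have p10 : p1.2 != 0 by rewrite -normr_eq0 n1 oner_eq0.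
    by case: (H_definite p1.1) => /(_ _ p10); [move/lt0r_neq0|move/ltr0_neq0].
  - exact: normr_ge0.
  - move=> p Kp; have pK : p \in K by rewrite inE.
    by apply/andP; split; [exact: p1P|exact: p2P].
exists c, C; split => // xi v xir.
have [->|v0] := eqVneq v 0.
  by rewrite hom0 !normr0 expr0n !mulr0 lexx.
have nv : 0 < `|v| by rewrite normr_gt0.
have /cC : K (xi, `|v|^-1 *: v).
  by split => //=; rewrite normrZ normfV normr_id mulVf// gt_eqF.
rewrite /G/= hom normrM normrX normfV normr_id exprVn.
by rewrite [_ ^- 2 * _]mulrC ler_pdivlMr ?exprn_gt0// ler_pdivrMr ?exprn_gt0.
Qed.

(** For v = x - k, Taylor's formula reads 0 = h dH(hk)(v) + h^2 d^2H(xi)(v,v) / 2. With b = dH(hk)/h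
    this is b(v) = - d^2H(xi)(v,v) / 2, where h occurs only through the point xi. *)
Lemma pinched_level_set (r : R) : exists c C : R, [/\ 0 < c, 0 <= C &
  forall (h l : R), 0 < h -> pinched c C
    [set k | H (h *: int_row k) = l /\ `|h *: int_row k| <= r]].
Proof.
have [c [C [c0 C0 cC]]] := hessian_bounds r.
exists (c / 2), (C / 2); split; [by rewrite divr_gt0|by rewrite divr_ge0|].
move=> h l h0 k [kl kr].
exists (\col_i ('D_(delta_mx 0 i) H (h *: int_row k) / h)) => x [xl xr].
set v := int_row (x - k).
have hv : h *: int_row x = h *: int_row k + h *: v.
  by rewrite /v int_rowB scalerBr addrC subrK.
have [t /andP[t0 t1]] := taylor2 (h *: int_row k) (h *: v).
rewrite -hv kl xl -addrA -[X in X = _]addr0 => /addrI.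
set xi := h *: int_row k + t *: (h *: v) => E.
(* The intermediate point lies on the segment from hk to hx, and the ball is convex. *)
have xir : `|xi| <= r.
  have -> : xi = (1 - t) *: (h *: int_row k) + t *: (h *: int_row x).
    by rewrite /xi hv scalerDr addrA scalerBl scale1r subrK.
  rewrite (le_trans (ler_normD _ _))// !normrZ (ger0_norm t0) ger0_norm ?subr_ge0//.
  rewrite -!normrZ [leRHS](_ : r = (1 - t) * r + t * r); last by ring.
  by rewrite lerD// ler_wpM2l// subr_ge0.
have -> : (v *m \col_i ('D_(delta_mx 0 i) H (h *: int_row k) / h)) 0 0 =
    - (hessian H xi v v / 2).
  have -> : (v *m \col_i ('D_(delta_mx 0 i) H (h *: int_row k) / h)) 0 0 =
      'D_(h *: v) H (h *: int_row k) / h ^+ 2.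
    rewrite derive_coord// mxE mulr_suml; apply: eq_bigr => i _; rewrite !mxE.
    by field; exact: lt0r_neq0.
  move/esym/eqP: E; rewrite addr_eq0 => /eqP ->.
  rewrite !hessian_coord mulNr; congr (- _); rewrite !mulr_suml; apply: eq_bigr => i _.
  rewrite !mulr_suml; apply: eq_bigr => j _; rewrite !mxE.
  by field; exact: lt0r_neq0.
rewrite normrN normrM [`|2^-1|]ger0_norm// ![_ / 2 * _]mulrAC.
by rewrite !ler_pM2r// cC.
Qed.

End taylor.

(** * Integrals of the characters *)

Section cosine_integrals.
Context {R : realType}.
Local Notation lebesgue := (@lebesgue_measure R).

Lemma measurable_cos : measurable_fun [set: R] (@cos R).
Proof. by apply: continuous_measurable_fun; exact: continuous_cos. Qed.

Lemma sin_periodz (n : int) (x : R) : sin (x + n%:~R * (2 * pi)) = sin x.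
Proof.
have H m (y : R) : sin (y + m%:R * (2 * pi)) = sin y.
  by rewrite mulr_natl -mulr_natl (mulr_natl pi) -(periodicn (@sinD2pi R) m y) mulr_natl.
case: n => m; first exact: H.
rewrite NegzE.
by rewrite -(H m.+1 (x + _)) mulrNz mulNr subrK.
Qed.

Lemma cos_periodz (n : int) (x : R) : cos (x + n%:~R * (2 * pi)) = cos x.
Proof. by rewrite -!sinDpihalf addrAC sin_periodz. Qed.

(** The arbitrary phase [c] absorbs the other variables when Fubini's theorem singles one out, and
    later turns cosines into sines. *)
Lemma integral_cos_period (k : int) (c : R) : k != 0 ->
  (\int[lebesgue]_(x in `[0%R, (2 * pi)%R[) (cos (k%:~R * x + c))%:E = 0)%E.
Proof.
move=> k0; have kR0 : k%:~R != 0 :> R by rewrite intr_eq0.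
have Dl (x : R) : is_derive x 1 (fun x => sin (k%:~R * x + c) / k%:~R)
    (cos (k%:~R * x + c)).
  have Dlin : is_derive x 1 (fun x : R => k%:~R * x + c) k%:~R.
    by apply: is_derive_eq; rewrite /GRing.scale/= ?(mulr0, mul0r, addr0, add0r, mulr1).
  apply: is_derive_eq; rewrite /GRing.scale/= ?(mulr0, mul0r, addr0, add0r, mulr1).
  by rewrite mulrCA mulVf ?mulr1.
have cF : continuous (fun x : R => sin (k%:~R * x + c) / k%:~R).
  move=> x; apply: differentiable_continuous; apply/derivable1_diffP.
  by have [] := Dl x.
have clin : continuous (fun x : R => k%:~R * x + c).
  by move=> x; apply: cvgD; [apply: cvgM; [exact: cvg_cst|exact: cvg_id]|exact: cvg_cst].
have cf : continuous (fun x : R => cos (k%:~R * x + c)).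
  by move=> x; apply: continuous_comp; [exact: clin|exact: continuous_cos].
rewrite integral_itv_bndo_bndc; last first.
  apply/measurable_EFinP/measurable_funTS; exact: continuous_measurable_fun.
rewrite (@continuous_FTC2 _ _ (fun x => sin (k%:~R * x + c) / k%:~R)).
- by rewrite mulr0 add0r [_ + c]addrC sin_periodz -EFinB subrr.
- by rewrite mulr_gt0// pi_gt0.
- exact: continuous_subspaceT.
- split; [by move=> x _; have [] := Dl x| |].
  + exact: cvg_at_right_filter (cF _).
  + exact: cvg_at_left_filter (cF _).
- by move=> x _; rewrite derive1E derive_val.
Qed.

Definition phase n (k : 'rV[int]_n) (t : n.-tuple (measurableTypeR R)) : R :=
  \sum_i (k 0 i)%:~R * tnth t i.

Lemma measurable_phase n (k : 'rV[int]_n) : measurable_fun setT (phase k).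
Proof.
apply: measurable_sum => i; apply: measurable_funM; first exact: measurable_cst.
exact: measurable_tnth.
Qed.

Local Notation cube n := (@fundamental_cube R n).

Lemma preimage_cons_cube n :
  @cons_pair R n @^-1` cube n.+1 = `[0, 2 * pi[%classic `*` cube n.
Proof.
apply/seteqP; split => -[x t] /=.
  move=> xt; split; first by have := xt ord0; rewrite /= tnth0.
  by move=> i; have := xt (lift ord0 i); rewrite /= tnthS.
by move=> [/= x01 t01] i; case: (unliftP ord0 i) => [j|] ->; rewrite ?tnthS ?tnth0.
Qed.

Lemma measure_cube n : lebesgue_tuple R n (cube n) = ((2 * pi) ^+ n)%:E.
Proof.
elim: n => [|n IH]; first by rewrite /= diracE mem_set// => -[].
rewrite /= /cons_product /pushforward preimage_cons_cube product_measure1E//=.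
- rewrite [X in (_ * X)%E]IH lebesgue_measure_itv/= lte_fin mulr_gt0 ?pi_gt0//.
  by rewrite -EFinB subr0 -EFinM exprS.
- exact: measurable_fundamental_cube.
Qed.

Lemma cube_lty n : (lebesgue_tuple R n (cube n) < +oo)%E.
Proof. by rewrite measure_cube ltry. Qed.

Lemma phase_cons n (k : 'rV[int]_n.+1) (p : measurableTypeR R * n.-tuple (measurableTypeR R)) :
  phase k (cons_pair p) = (k 0 ord0)%:~R * p.1 + phase (\row_i k 0 (lift ord0 i)) p.2.
Proof.
rewrite /phase big_ord_recl /= tnth0; congr (_ + _).
by apply: eq_bigr => i _; rewrite mxE tnthS.
Qed.

Lemma integral_cos_cube n (k : 'rV[int]_n) (c : R) : k != 0 ->
  (\int[lebesgue_tuple R n]_(t in cube n) (cos (phase k t + c))%:E = 0)%E.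
Proof.
elim: n k c => [k c|n IH k c k0]; first by rewrite thinmx0 eqxx.
have m_cos : measurable_fun setT (fun t => cos (phase k t + c)).
  apply: measurableT_comp; first exact: measurable_cos.
  by apply: measurable_funD; [exact: measurable_phase|exact: measurable_cst].
have mI : measurable (`[0, 2 * pi[%classic : set (measurableTypeR R)) by exact: measurable_itv.
have mC := @measurable_fundamental_cube R n.
have mIC := measurableX mI mC.
pose G (p : measurableTypeR R * n.-tuple (measurableTypeR R)) :=
  (cos (phase k (cons_pair p) + c))%:E.
have mG : measurable_fun setT G.
  apply/measurable_EFinP; apply: (measurableT_comp m_cos).
  exact: measurable_cons_pair.
have fin_IC : ((lebesgue \x lebesgue_tuple R n)%E (`[0%R, (2 * pi)%R[%classic `*` cube n) < +oo)%E.
  have -> : ((lebesgue \x lebesgue_tuple R n)%E (`[0%R, (2 * pi)%R[%classic `*` cube n) =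
      lebesgue `[0%R, (2 * pi)%R[%classic * lebesgue_tuple R n (cube n))%E.
    exact: product_measure1E.
  rewrite measure_cube lebesgue_measure_itv/= lte_fin.
  by case: ifP => _; rewrite ?mul0e ?ltry// -EFinB -EFinM ltry.
have iG : (lebesgue \x lebesgue_tuple R n)%E.-integrable
    (`[0, 2 * pi[%classic `*` cube n) G.
  apply: measurable_bounded_integrable => //.
  - by apply: measurable_funTS; exact/measurable_EFinP.
  - exists 1; split; first exact: num_real.
    by move=> y y1 p _; apply: le_trans (ltW y1); exact: cos_max.
transitivity (\int[(lebesgue \x lebesgue_tuple R n)%E]_(p in
    `[0%R, (2 * pi)%R[%classic `*` cube n) G p)%E.
  rewrite /= -preimage_cons_cube; apply: integral_pushforward.
  - exact: measurable_cons_pair.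
  - exact/measurable_EFinP.
  - by rewrite preimage_cons_cube.
  - exact: measurable_fundamental_cube.
have iG' := proj1 (@integrable_mkcond _ _ _ (lebesgue \x lebesgue_tuple R n)%E _ G mIC) iG.
rewrite integral_mkcond -integral21_prod_meas1; last exact: iG'.
have fubE (t : n.-tuple (measurableTypeR R)) : fubini_G lebesgue (G \_
    (`[0, 2 * pi[%classic `*` cube n)) t =
    ((fun t => \int[lebesgue]_(x in `[0%R, (2 * pi)%R[)
       (cos ((k 0 ord0)%:~R * x + (phase (\row_i k 0 (lift ord0 i)) t + c)))%:E)%E \_ (cube n)) t.
  rewrite /fubini_G [RHS]patchE; case: ifPn => tC; last first.
    rewrite integral0_eq// => x _; rewrite patchE; case: ifPn => //.
    by rewrite inE => -[_ /mem_set]; rewrite (negbTE tC).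
  rewrite [RHS]integral_mkcond; apply: eq_integral => x _; rewrite !patchE.
  have -> : ((x, t) \in `[0, 2 * pi[%classic `*` cube n) = (x \in `[0, 2 * pi[%classic).
    apply/idP/idP; rewrite !inE; first by case.
    by move=> x01; split => //=; exact: set_mem.
  by case: ifP => // _; rewrite /G phase_cons addrA.
under eq_integral do rewrite fubE.
rewrite -integral_mkcond.
(* A nonzero first frequency already makes the inner integral vanish; otherwise the remaining
   frequencies form a nonzero vector and the induction hypothesis applies. *)
have [k00|k00] := eqVneq (k 0 ord0) 0; last first.
  by apply: integral0_eq => t _; exact: integral_cos_period.
set k' := \row_i k 0 (lift ord0 i).
have k'0 : k' != 0.
  apply: contra k0 => /eqP/rowP k'0; apply/eqP/rowP => i; rewrite mxE.
  by case: (unliftP ord0 i) => [j|] -> //; have := k'0 j; rewrite !mxE.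
under eq_integral do (under eq_integral do rewrite k00 mul0r add0r).
transitivity ((2 * pi)%:E * \int[lebesgue_tuple R n]_(t in cube n) (cos (phase k' t + c))%:E)%E.
  rewrite -integralZl//; last first.
    apply: measurable_bounded_integrable => //.
    - exact: cube_lty.
    - apply: measurable_funTS; apply: measurableT_comp; first exact: measurable_cos.
      by apply: measurable_funD; [exact: measurable_phase|exact: measurable_cst].
    - exists 1; split; first exact: num_real.
      by move=> y y1 p _; apply: le_trans (ltW y1); exact: cos_max.
  have int_cst (r : \bar R) :
      (\int[lebesgue]_(x in `[0%R, (2 * pi)%R[) r = (2 * pi)%:E * r)%E.
    transitivity (r * lebesgue `[0%R, (2 * pi)%R[%classic)%E; first exact: integral_cst.
    rewrite lebesgue_measure_itv/= lte_fin.
    by rewrite mulr_gt0 ?pi_gt0// -EFinB subr0 muleC.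
  by apply: eq_integral => t _; exact: int_cst.
by rewrite IH// mule0.
Qed.

End cosine_integrals.

(** * Characters on the quotient torus *)

Section torus_integrals.
Local Open Scope quotient_scope.
Context {R : realType} {d : nat}.
Local Notation T := (torus R d).
Local Notation dx := (lebesgue_torus R d).
Implicit Types (k l : 'rV[int]_d) (f : T -> R).

Definition angle k (x : 'rV[R]_d) : R := \sum_i (k 0 i)%:~R * x 0 i.

Lemma angle_mod_2pi k (x y : 'rV[R]_d) : same_mod_2pi x y ->
  exists n : int, angle k x = angle k y + n%:~R * (2 * pi).
Proof.
move=> /forallP xy.
have pi0 : 2 * pi != 0 :> R by rewrite mulf_neq0// gt_eqF// pi_gt0.
have /choice[n nP] : forall i, exists n : int, x 0 i = y 0 i + n%:~R * (2 * pi).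
  move=> i; have /intrP[n nE] := xy i; exists n.
  by rewrite -nE mulfVK// addrC subrK.
exists (\sum_i k 0 i * n i).
rewrite rmorph_sum/= mulr_suml -big_split/=; apply: eq_bigr => i _.
by rewrite nP mulrDr rmorphM/= mulrA.
Qed.

Lemma repr_same_mod_2pi (x : 'rV[R]_d) : same_mod_2pi (repr (\pi_T x)) x.
Proof. by apply/(@eqmodP _ (same_mod_2pi_equiv d)); exact: (@reprK _ T). Qed.

(** The choice made by [repr] disappears here, so that continuity on the quotient can be checked on
    R^d. *)
Lemma expi_pi k (x : 'rV[R]_d) :
  expi k (\pi_T x) = (cos (angle k x) +i* sin (angle k x))%C.
Proof.
rewrite /expi -/(angle k _); have [n ->] := angle_mod_2pi k (repr_same_mod_2pi x).
by rewrite cos_periodz sin_periodz.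
Qed.

Lemma continuous_angle k : continuous (angle k).
Proof.
move=> x; rewrite (_ : angle k = \sum_i (fun y : 'rV[R]_d => (k 0 i)%:~R * y 0 i)).
  apply: (big_ind (fun f : 'rV[R]_d -> R => {for x, continuous f})).
  - exact: cst_continuous.
  - by move=> f g cf cg; exact: continuousD.
  - move=> i _; apply: continuousM; [exact: cst_continuous|exact: coord_continuous].
by apply/funext => y; rewrite fct_sumE.
Qed.

Lemma continuous_torus f (g : 'rV[R]_d -> R) :
  (forall x, f (\pi_T x) = g x) -> continuous g -> continuous f.
Proof.
move=> fg cg; apply/(@quotient_continuous _ {eq_quot same_mod_2pi_equiv d}).
by rewrite (_ : _ \o _ = g)//; apply/funext.
Qed.

Lemma continuous_Re_expi k : continuous (fun x : T => complex.Re (expi k x)).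
Proof.
apply: (@continuous_torus _ (cos \o angle k)) => x; first by rewrite expi_pi.
apply: continuous_comp; [exact: continuous_angle|exact: continuous_cos].
Qed.

Lemma continuous_Im_expi k : continuous (fun x : T => complex.Im (expi k x)).
Proof.
apply: (@continuous_torus _ (sin \o angle k)) => x; first by rewrite expi_pi.
apply: continuous_comp; [exact: continuous_angle|exact: continuous_sin].
Qed.

Lemma expi0 (x : T) : expi 0 x = 1.
Proof.
rewrite /expi big1 => [|i _]; first by rewrite cos0 sin0.
by rewrite mxE mul0r.
Qed.

Lemma expiD k l (x : T) : expi (k + l) x = expi k x * expi l x.
Proof.
rewrite /expi -!/(angle _ (repr x)).
have -> : angle (k + l) (repr x) = angle k (repr x) + angle l (repr x).
  rewrite /angle -big_split/=; apply: eq_bigr => i _.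
  by rewrite mxE rmorphD/= mulrDl.
rewrite cosD sinD; apply/eqP; rewrite eq_complex /=; apply/andP; split; apply/eqP => //.
by rewrite addrC.
Qed.

Lemma conj_expi k (x : T) : (expi k x)^*%C = expi (- k) x.
Proof.
rewrite /expi -!/(angle _ (repr x)).
have -> : angle (- k) (repr x) = - angle k (repr x).
  rewrite /angle -sumrN/=; apply: eq_bigr => i _.
  by rewrite mxE rmorphN/= mulNr.
by rewrite cosN sinN.
Qed.

Lemma continuous_measurable_torus f : continuous f -> measurable_fun setT f.
Proof.
move=> /continuousP cf; apply: (measurability _ (RGenOpens.measurableE R)).
move=> _ [_ [a [b ->] <-]]; rewrite setTI; apply: (@sub_sigma_algebra _ setT (@open T)).
by apply: cf; exact: interval_open.
Qed.

Lemma lebesgue_torusT : dx setT = ((2 * pi) ^+ d)%:E.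
Proof. by rewrite /lebesgue_torus /pushforward /mrestr preimage_setT setTI measure_cube. Qed.

Lemma lebesgue_torus_integral_cos k (c : R) : k != 0 ->
  (\int[dx]_x (cos (angle k (repr x) + c))%:E = 0)%E.
Proof.
move=> k0; pose f (x : T) := cos (angle k (repr x) + c).
have mf : measurable_fun setT f.
  apply: continuous_measurable_torus.
  apply: (@continuous_torus _ (fun x => cos (angle k x + c))) => x.
    rewrite /f; have [n ->] := angle_mod_2pi k (repr_same_mod_2pi x).
    by rewrite addrAC cos_periodz.
  apply: (continuous_comp (f := fun x => angle k x + c)); last exact: continuous_cos.
  apply: (@continuousD _ _ _ (angle k) (fun=> c)); first exact: continuous_angle.
  exact: cst_continuous.
have mcube := @measurable_fundamental_cube R d.
set m := mrestr (lebesgue_tuple R d) mcube.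
have im : m.-integrable setT (fun t => (f (torus_proj t))%:E).
  apply: measurable_bounded_integrable => //.
  - by rewrite /m /= /mrestr setTI cube_lty.
  - apply: (measurableT_comp mf); exact: measurable_torus_proj.
  - exists 1; split; first exact: num_real.
    by move=> y y1 p _; apply: le_trans (ltW y1); exact: cos_max.
transitivity (\int[m]_t (f (torus_proj t))%:E)%E.
  have mfE : measurable_fun setT (EFin \o f) by exact/measurable_EFinP.
  rewrite -(preimage_setT (@torus_proj R d)) in im *.
  exact: (@integral_pushforward _ _ _ _ _ _ (@measurable_torus_proj R d) m
    setT (EFin \o f) mfE im measurableT).
rewrite (negligible_integral (measurableC mcube))//; last first.
  by rewrite /m /= /mrestr setICl measure0.
rewrite setDE setCK setTI -[RHS](integral_cos_cube c k0).
transitivity (\int[lebesgue_tuple R d]_(t in @fundamental_cube R d) (f (torus_proj t))%:E)%E.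
  apply: eq_measure_integral => A mA Acube; rewrite /m /= /mrestr.
  by congr (lebesgue_tuple R d _); exact/setIidl.
apply: eq_integral => t _; rewrite /f /torus_proj.
have [n ->] := angle_mod_2pi k (repr_same_mod_2pi (row_of_tuple t)).
rewrite addrAC cos_periodz; congr (cos (_ + _))%:E.
by apply: eq_bigr => i _; rewrite mxE.
Qed.

End torus_integrals.

(** * Uniform limits of trigonometric polynomials *)

Section trigonometric_polynomials.
Local Open Scope quotient_scope.
Context {R : realType} {d : nat}.
Local Notation T := (torus R d).
Local Notation Z := 'rV[int]_d.
Implicit Types (f g : T -> R) (s : seq (Z * R[i])).

Definition trigpoly s (x : T) : R[i] := \sum_(p <- s) p.2 * expi p.1 x.

Definition real_trig f := exists s, forall x, (f x)%:C%C = trigpoly s x.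

Lemma real_trig_cst (c : R) : real_trig (fun=> c).
Proof.
exists [:: (0, c%:C%C)] => x.
by rewrite /trigpoly big_seq1/= expi0 mulr1.
Qed.

Lemma real_trigD f g : real_trig f -> real_trig g -> real_trig (fun x => f x + g x).
Proof.
move=> [s fs] [t gt]; exists (s ++ t) => x.
by rewrite /trigpoly big_cat/= rmorphD/= fs gt.
Qed.

Lemma real_trigM f g : real_trig f -> real_trig g -> real_trig (fun x => f x * g x).
Proof.
move=> [s fs] [t gt].
exists [seq (p.1 + q.1, p.2 * q.2) | p <- s, q <- t] => x.
rewrite /trigpoly big_allpairs_dep/= rmorphM/= fs gt /trigpoly mulr_suml.
apply: eq_bigr => p _; rewrite mulr_sumr; apply: eq_bigr => q _.
by rewrite expiD mulrACA.
Qed.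

Lemma real_trig_cos (k : Z) (c : R) : real_trig (fun x => cos (angle k (repr x) + c)).
Proof.
exists [:: (k, (cos c / 2 +i* (sin c / 2))%C); (- k, (cos c / 2 -i* (sin c / 2))%C)] => x.
rewrite /trigpoly big_cons big_seq1/= -conj_expi /expi -/(angle k (repr x)) cosD.
apply/eqP; rewrite eq_complex/=; apply/andP; split; apply/eqP; by field.
Qed.

Lemma trigpoly_continuous_bounded s :
  [/\ continuous (fun x => complex.Re (trigpoly s x)),
      continuous (fun x => complex.Im (trigpoly s x)) &
      exists B : R, forall x, `|complex.Re (trigpoly s x)| <= B /\
                              `|complex.Im (trigpoly s x)| <= B].
Proof.
elim: s => [|[k c] s [cR cI [B BP]]].
  have E x : trigpoly [::] x = 0 by rewrite /trigpoly big_nil.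
  split; [| |by exists 0 => x; rewrite E/= normr0].
  - by under eq_fun do rewrite E; exact: cst_continuous.
  - by under eq_fun do rewrite E; exact: cst_continuous.
have E x : trigpoly ((k, c) :: s) x = c * expi k x + trigpoly s x.
  by rewrite /trigpoly big_cons.
have ER x : complex.Re (trigpoly ((k, c) :: s) x) =
    complex.Re c * complex.Re (expi k x) - complex.Im c * complex.Im (expi k x)
    + complex.Re (trigpoly s x).
  by rewrite E; case: (c) (expi k x) (trigpoly s x) => [? ?] [? ?] [? ?].
have EI x : complex.Im (trigpoly ((k, c) :: s) x) =
    complex.Re c * complex.Im (expi k x) + complex.Im c * complex.Re (expi k x)
    + complex.Im (trigpoly s x).
  rewrite E; case: (c) (expi k x) (trigpoly s x) => [a b] [a' b'] [? ?] /=.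
  by rewrite [b * a']mulrC [a' * b]mulrC.
have [cRe cIm] := (@continuous_Re_expi R d k, @continuous_Im_expi R d k).
split.
- under eq_fun do rewrite ER.
  move=> x; apply: (@continuousD _ _ _ (fun x => complex.Re c * complex.Re (expi k x)
    - complex.Im c * complex.Im (expi k x))); last exact: cR.
  apply: (@continuousB _ _ _ (fun x => complex.Re c * complex.Re (expi k x))).
    apply: (@continuousM _ _ (fun=> complex.Re c)); [exact: cst_continuous|exact: cRe].
  apply: (@continuousM _ _ (fun=> complex.Im c)); [exact: cst_continuous|exact: cIm].
- under eq_fun do rewrite EI.
  move=> x; apply: (@continuousD _ _ _ (fun x => complex.Re c * complex.Im (expi k x)
    + complex.Im c * complex.Re (expi k x))); last exact: cI.
  apply: (@continuousD _ _ _ (fun x => complex.Re c * complex.Im (expi k x))).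
    apply: (@continuousM _ _ (fun=> complex.Re c)); [exact: cst_continuous|exact: cIm].
  apply: (@continuousM _ _ (fun=> complex.Im c)); [exact: cst_continuous|exact: cRe].
exists (`|complex.Re c| + `|complex.Im c| + B) => x.
have e1 : `|complex.Re (expi k x)| <= 1 by exact: cos_max.
have e2 : `|complex.Im (expi k x)| <= 1 by exact: sin_max.
have [B1 B2] := BP x; rewrite ER EI; split.
  rewrite (le_trans (ler_normD _ _))// lerD// (le_trans (ler_normB _ _))//.
  by rewrite !normrM lerD// ler_piMr.
rewrite (le_trans (ler_normD _ _))// lerD// (le_trans (ler_normD _ _))//.
by rewrite !normrM lerD// ler_piMr.
Qed.

Lemma real_trig_continuous f : real_trig f -> continuous f.
Proof.
move=> [s fs]; have [cR _ _] := trigpoly_continuous_bounded s.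
by rewrite (_ : f = fun x => complex.Re (trigpoly s x))//; apply/funext => x; rewrite -fs.
Qed.

Lemma real_trig_bounded f : real_trig f -> exists B : R, forall x, `|f x| <= B.
Proof.
move=> [s fs]; have [_ _ [B BP]] := trigpoly_continuous_bounded s.
by exists B => x; have [] := BP x; rewrite -fs.
Qed.

(** The uniform closure of the real trigonometric polynomials. As in the Stone-Weierstrass theorem,
    it is stable under absolute values, hence under maxima and minima. *)
Definition trig_limit f :=
  forall e : R, 0 < e -> exists2 g, real_trig g & forall x, `|f x - g x| <= e.

Lemma real_trig_limit f : real_trig f -> trig_limit f.
Proof. by move=> tf e e0; exists f => // x; rewrite subrr normr0 ltW. Qed.

Lemma trig_limit_bounded f : trig_limit f -> exists2 B : R, 0 < B & forall x, `|f x| <= B.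
Proof.
move=> /(_ 1 ltr01)[g /real_trig_bounded[B BP] fg].
exists (1 + `|B|); first by rewrite ltr_pwDl.
move=> x; rewrite -(subrK (g x) (f x)) (le_trans (ler_normD _ _))// lerD//.
by rewrite (le_trans (BP x))// ler_norm.
Qed.

Lemma trig_limit_continuous f : trig_limit f -> continuous f.
Proof.
move=> lf x; apply/(@cvgrPdist_le _ _ _ _ (nbhs_filter x)) => e e0.
have e3 : 0 < e / 3 by rewrite divr_gt0.
have [g /real_trig_continuous cg fg] := lf _ e3.
have /(@cvgrPdist_le _ _ _ _ (nbhs_filter x))/(_ _ e3) := cg x.
apply: (@filterS _ _ (nbhs_filter x)) => y gxy.
have -> : f x - f y = (f x - g x) + (g x - g y) + (g y - f y) by ring.
have -> : e = e / 3 + e / 3 + e / 3 by field.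
rewrite (le_trans (ler_normD _ _))// lerD//; last by rewrite distrC.
by rewrite (le_trans (ler_normD _ _))// lerD.
Qed.

Lemma trig_limit_lim f : (forall e : R, 0 < e ->
  exists2 g, trig_limit g & forall x, `|f x - g x| <= e) -> trig_limit f.
Proof.
move=> lf e e0; have e2 : 0 < e / 2 by rewrite divr_gt0.
have [g lg fg] := lf _ e2; have [h th gh] := lg _ e2.
exists h => // x; rewrite -(subrKA (g x)) (le_trans (ler_normD _ _))//.
by rewrite (splitr e) lerD.
Qed.

Lemma trig_limit_cst (c : R) : trig_limit (fun=> c).
Proof. exact/real_trig_limit/real_trig_cst. Qed.

Lemma trig_limitD f g : trig_limit f -> trig_limit g -> trig_limit (fun x => f x + g x).
Proof.
move=> lf lg e e0; have e2 : 0 < e / 2 by rewrite divr_gt0.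
have [f' tf ff'] := lf _ e2; have [g' tg gg'] := lg _ e2.
exists (fun x => f' x + g' x); first exact: real_trigD.
move=> x; rewrite opprD addrACA (le_trans (ler_normD _ _))//.
by rewrite (splitr e) lerD.
Qed.

Lemma trig_limitM f g : trig_limit f -> trig_limit g -> trig_limit (fun x => f x * g x).
Proof.
move=> lf lg e e0.
have [B B0 fB] := trig_limit_bounded lf.
have eB : 0 < e / (2 * B) by rewrite divr_gt0// mulr_gt0.
have [g' tg gg'] := lg _ eB.
have [B' B'P] := real_trig_bounded tg.
have B'0 : 0 < `|B'| + 1 by rewrite ltr_wpDl.
have eB' : 0 < e / (2 * (`|B'| + 1)) by rewrite divr_gt0// mulr_gt0.
have [f' tf ff'] := lf _ eB'.
exists (fun x => f' x * g' x); first exact: real_trigM.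
move=> x; have -> : f x * g x - f' x * g' x =
  f x * (g x - g' x) + (f x - f' x) * g' x by ring.
rewrite (le_trans (ler_normD _ _))// !normrM.
have -> : e = B * (e / (2 * B)) + e / (2 * (`|B'| + 1)) * (`|B'| + 1).
  by field; rewrite !gt_eqF.
rewrite lerD// ler_pM//.
by rewrite (le_trans (B'P x))// (le_trans (ler_norm _))// lerDl.
Qed.

Lemma trig_limitZ (c : R) f : trig_limit f -> trig_limit (fun x => c * f x).
Proof. by move=> lf; apply: trig_limitM => //; exact: trig_limit_cst. Qed.

Lemma trig_limitB f g : trig_limit f -> trig_limit g -> trig_limit (fun x => f x - g x).
Proof.
move=> lf lg; under eq_fun do rewrite -mulN1r.
by apply: trig_limitD => //; exact: trig_limitZ.
Qed.

(* The fixed points of p |-> p + (t^2 - p^2) / 2 are t and -t. *)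
Fixpoint abs_approx (n : nat) (t : R) : R :=
  if n is n'.+1 then abs_approx n' t + (t ^+ 2 - abs_approx n' t ^+ 2) / 2 else 0.

(** The error e = |t| - p becomes e (1 - (e + 2 p) / 2) <= e (1 - e / 2). The map e |-> e (1 - e /
    2) is increasing on [0, 1] and sends 2 / N to at most 2 / (N + 1). *)
Lemma abs_approxP (n : nat) (t : R) : `|t| <= 1 ->
  0 <= abs_approx n t <= `|t| /\ `|t| - abs_approx n t <= 2 / n.+2%:R.
Proof.
move=> t1; rewrite -normr_id in t1; set a := `|t|.
have a0 : 0 <= a by exact: normr_ge0.
have at2 : t ^+ 2 = a ^+ 2 by rewrite /a -normrX ger0_norm// sqr_ge0.
have {}t1 : a <= 1 by move: t1; rewrite /a normr_id.
elim: n => [|n [/andP[p0 pa] IH]] /=.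
  by rewrite lexx a0 subr0 divff// t1.
rewrite at2; move: (abs_approx n t) p0 pa IH => p p0 pa IH.
have n3 : 0 < n.+3%:R :> R by [].
have n2 : 0 < n.+2%:R :> R by [].
have Dn : n.+3%:R = n.+2%:R + 1 :> R by rewrite natr1.
split; first by apply/andP; split; nra.
rewrite ler_pdivlMr// Dn.
move: IH; rewrite ler_pdivlMr// => IH.
have {n3 Dn} : 2 <= n.+2%:R :> R by rewrite ler_nat.
move: (n.+2%:R) n2 IH => N n2 IH N2.
set e := a - p in IH *.
have e0 : 0 <= e by rewrite subr_ge0.
have e1 : e <= 1 by rewrite /e; lra.
have -> : a - (p + (a ^+ 2 - p ^+ 2) / 2) = e * (1 - (e + 2 * p) / 2) by rewrite /e; field.
have : e * (1 - (e + 2 * p) / 2) <= e * (1 - e / 2).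
  by rewrite ler_wpM2l//; lra.
move=> H; apply: (@le_trans _ _ (e * (1 - e / 2) * (N + 1))).
  by rewrite ler_wpM2r//; lra.
nra.
Qed.

Lemma trig_limit_abs f : trig_limit f -> trig_limit (fun x => `|f x|).
Proof.
move=> lf; have [B B0 fB] := trig_limit_bounded lf.
have la n : trig_limit (fun x => abs_approx n (B^-1 * f x)).
  elim: n => [|n IH] /=; first exact: trig_limit_cst.
  apply: trig_limitD => //; under eq_fun do rewrite mulrC !expr2.
  have lBf := trig_limitZ B^-1 lf.
  by apply: trig_limitZ; apply: trig_limitB; exact: trig_limitM.
apply: trig_limit_lim => e e0.
pose n := Num.truncn (2 * B / e).
exists (fun x => B * abs_approx n (B^-1 * f x)); first exact: trig_limitZ.
move=> x; have fx1 : `|B^-1 * f x| <= 1.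
  by rewrite normrM normfV (gtr0_norm B0) mulrC ler_pdivrMr// mul1r.
have [/andP[_ pa] pe] := abs_approxP n fx1.
have -> : `|f x| - B * abs_approx n (B^-1 * f x) =
    B * (`|B^-1 * f x| - abs_approx n (B^-1 * f x)).
  by rewrite normrM normfV (gtr0_norm B0) mulrBr mulrA divff ?gt_eqF// mul1r.
rewrite ger0_norm; last by rewrite mulr_ge0 ?(ltW B0)// subr_ge0.
apply: le_trans (ler_wpM2l (ltW B0) pe) _.
rewrite mulrA [B * 2]mulrC ler_pdivrMr// -ler_pdivrMl// [e^-1 * _]mulrC.
rewrite (le_trans (ltW (truncnS_gt _)))// ler_nat.
by rewrite -/n leqnSn.
Qed.

Lemma maxr_abs (a b : R) : Num.max a b = (a + b + `|a - b|) / 2.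
Proof.
by case: (leP a b) => ab; [rewrite ler0_norm ?subr_le0//|rewrite gtr0_norm ?subr_gt0//]; field.
Qed.

Lemma minr_abs (a b : R) : Num.min a b = (a + b - `|a - b|) / 2.
Proof.
by case: (leP a b) => ab; [rewrite ler0_norm ?subr_le0//|rewrite gtr0_norm ?subr_gt0//]; field.
Qed.

Lemma trig_limit_max f g : trig_limit f -> trig_limit g ->
  trig_limit (fun x => Num.max (f x) (g x)).
Proof.
move=> lf lg; under eq_fun do rewrite maxr_abs mulrC.
apply: trig_limitZ; apply: trig_limitD; first exact: trig_limitD.
by apply: trig_limit_abs; exact: trig_limitB.
Qed.

Lemma trig_limit_min f g : trig_limit f -> trig_limit g ->
  trig_limit (fun x => Num.min (f x) (g x)).
Proof.
move=> lf lg; under eq_fun do rewrite minr_abs mulrC.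
apply: trig_limitZ; apply: trig_limitB; first exact: trig_limitD.
by apply: trig_limit_abs; exact: trig_limitB.
Qed.

Lemma cos_near_1 (e : R) : 0 < e -> exists2 del : R, 0 < del &
  forall t : R, 1 - cos t < del -> exists n : int, `|t - n%:~R * (2 * pi)| < e.
Proof.
move=> e0; have pi_gt0 := pi_gt0 R.
pose e' := Num.min e pi.
have e'0 : 0 < e' by rewrite lt_min e0.
have e'pi : e' <= pi by rewrite ge_min lexx orbT.
exists (1 - cos e').
  rewrite subr_gt0 -[ltRHS]cos0 ltr_cos ?in_itv/= ?lexx ?(ltW e'0) ?e'pi ?(ltW pi_gt0)//.
(* Rounding t / (2 pi) to a nearest integer leaves a remainder in [-pi, pi], where cosine is
   strictly monotone in the absolute value. *)
move=> t te; pose n := Num.floor ((t + pi) / (2 * pi)); exists n.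
have pi2 : 0 < 2 * pi :> R by rewrite mulr_gt0.
set t' := t - n%:~R * (2 * pi).
have t'pi : `|t'| <= pi.
  have := floor_le ((t + pi) / (2 * pi)); rewrite -/n ler_pdivlMr// => H1.
  have := floorD1_gt ((t + pi) / (2 * pi)); rewrite -/n ltr_pdivrMr// intrD => H2.
  by rewrite ler_norml /t'; apply/andP; split; lra.
have : cos e' < cos `|t'|.
  have -> : cos `|t'| = cos t'.
    by case: (ger0P t') => // _; rewrite cosN.
  have -> : cos t' = cos t by rewrite /t' -mulNr -rmorphN cos_periodz.
  lra.
rewrite ltr_cos ?in_itv/= ?normr_ge0 ?(ltW e'0) ?e'pi ?t'pi// => /lt_le_trans; apply.
by rewrite ge_min lexx.
Qed.

(** A neighbourhood of a rational point, cut out by the positivity of a trigonometric polynomial.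
    Rational centres and integer sizes make the family countable. *)
Definition cos_ball (q : 'rV[rat]_d * nat) : set T :=
  [set x | 0 < q.2.+1%:R^-1 - \sum_(i < d) (1 - cos (angle (delta_mx 0 i) (repr x) - ratr (q.1 0 i)))].

Lemma angle_delta (i : 'I_d) (x : 'rV[R]_d) : angle (delta_mx 0 i) x = x 0 i.
Proof.
rewrite /angle (bigD1 i)//= big1 => [|j ji].
  by rewrite mxE !eqxx mul1r addr0.
by rewrite mxE eqxx (negbTE ji) mul0r.
Qed.

Lemma trig_limit_sum (I : Type) (r : seq I) (F : I -> T -> R) :
  (forall i, trig_limit (F i)) -> trig_limit (fun x => \sum_(i <- r) F i x).
Proof.
move=> lF; elim: r => [|i r IH].
  by under eq_fun do rewrite big_nil; exact: trig_limit_cst.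
by under eq_fun do rewrite big_cons; exact: trig_limitD.
Qed.

Lemma cos_ball_trig q : exists2 g, trig_limit g & cos_ball q = [set x | 0 < g x].
Proof.
exists (fun x => q.2.+1%:R^-1 -
  \sum_(i < d) (1 - cos (angle (delta_mx 0 i) (repr x) - ratr (q.1 0 i)))) => //.
apply: trig_limitB; first exact: trig_limit_cst.
apply: trig_limit_sum => i; apply: trig_limitB; first exact: trig_limit_cst.
exact/real_trig_limit/real_trig_cos.
Qed.

Lemma cos_ball_basis (U : set T) (x : T) : open U -> U x ->
  exists2 q, cos_ball q x & cos_ball q `<=` U.
Proof.
move=> oU Ux; set xi := repr x.
have pixi : \pi_T xi = x by exact: reprK.
have oV : open [set y : 'rV[R]_d | U (\pi_T y)] by exact: oU.
have /nbhs_ballP[e /= e0 eV] : nbhs xi [set y : 'rV[R]_d | U (\pi_T y)].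
  by apply: open_nbhs_nbhs; split => //=; rewrite pixi.
have e2 : 0 < e / 2 by rewrite divr_gt0.
have [del del0 delP] := cos_near_1 e2.
pose n := Num.truncn del^-1.
have ndel : n.+1%:R^-1 < del.
  by rewrite -[ltRHS]invrK ltf_pV2 ?posrE ?invr_gt0// truncnS_gt.
(* A sum of d terms of this size stays strictly below 1/(n+1); taking d+1 also covers d = 0. *)
have c0 : 0 < (n.+1%:R * d.+1%:R)^-1 :> R by rewrite invr_gt0 mulr_gt0.
have [rho rho0 rhoP] : exists2 rho : R, 0 < rho &
    forall t : R, `|t| < rho -> 1 - cos t < (n.+1%:R * d.+1%:R)^-1.
  have /cvgrPdist_lt/(_ _ c0)/nbhs_ballP[rho /= rho0 rhoP] := @continuous_cos R 0.
  exists rho => // t tr; have := rhoP t; rewrite /ball/= sub0r normrN => /(_ tr).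
  by rewrite cos0; apply: le_lt_trans; exact: ler_norm.
have /choice[y yP] : forall i, exists q : rat, `|xi 0 i - ratr q| < rho.
  move=> i; have lti : xi 0 i - rho < xi 0 i by rewrite ltrBlDr ltrDl.
  have [q] := rat_in_itvoo lti; rewrite in_itv/= => /andP[q1 q2].
  by exists q; rewrite ltr_norml; apply/andP; split; lra.
have near q (z : T) : cos_ball q z -> forall i : 'I_d,
    1 - cos (repr z 0 i - ratr (q.1 0 i)) < q.2.+1%:R^-1.
  rewrite /cos_ball/= subr_gt0 => zq i; apply: le_lt_trans zq.
  rewrite (bigD1 i)//= angle_delta lerDl; apply: sumr_ge0 => j _.
  by rewrite subr_ge0; exact: cos_le1.
have xq : cos_ball (\row_i y i, n) x.
  rewrite /cos_ball/= subr_gt0.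
  apply: (@le_lt_trans _ _ (\sum_(i < d) (n.+1%:R * d.+1%:R)^-1)).
    by apply: ler_sum => i _; rewrite angle_delta mxE ltW// rhoP.
  rewrite sumr_const card_ord -[ltLHS]mulr_natr invfM -mulrA gtr_pMr ?invr_gt0//.
  by rewrite mulrC ltr_pdivrMr// mul1r ltr_nat.
exists (\row_i y i, n) => // z zq.
have pz : \pi_T (repr z) = z by exact: reprK.
have /choice[m mP] : forall i, exists m : int,
    `|repr z 0 i - ratr (y i) - m%:~R * (2 * pi)| < e / 2.
  by move=> i; apply: delP; apply: lt_trans ndel; have := near _ _ zq i; rewrite /= mxE.
have /choice[m' m'P] : forall i, exists m : int,
    `|xi 0 i - ratr (y i) - m%:~R * (2 * pi)| < e / 2.
  by move=> i; apply: delP; apply: lt_trans ndel; have := near _ _ xq i; rewrite /= mxE.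
(* Modulo 2 pi, both z and x are within e/2 of the centre. Shifting the representative of z by the
   difference of the two multiples of 2 pi brings it within e of [xi]. *)
pose w := \row_i (repr z 0 i - (m i - m' i)%:~R * (2 * pi)).
have -> : z = \pi_T w.
  rewrite -pz; apply/(@eqmodP _ (same_mod_2pi_equiv d)); apply/forallP => i.
  rewrite mxE opprB addrC subrK mulfK ?intr_int//.
  by rewrite mulf_neq0// gt_eqF// pi_gt0.
apply: eV; split => // i j; rewrite ord1 /ball/= mxE.
have := mP j; have := m'P j; rewrite intrB mulrBl.
move: (m' j)%:~R (m j)%:~R => A B; rewrite !ltr_norml => /andP[? ?] /andP[? ?].
by apply/andP; split; lra.
Qed.

(** A pi-system for Dynkin's theorem whose indicator functions are visibly limits of functions in
    [trig_limit]. *)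
Definition trig_pos : set (set T) := [set A | exists2 g, trig_limit g & A = [set x | 0 < g x]].

Lemma trig_pos_open A : trig_pos A -> open A.
Proof.
move=> [g /trig_limit_continuous/continuousP cg ->].
have -> : [set x | 0 < g x] = g @^-1` [set t | 0 < t] by [].
by apply: cg; exact: open_gt.
Qed.

Lemma trig_pos_setI : setI_closed trig_pos.
Proof.
move=> _ _ [g lg ->] [h lh ->].
exists (fun x => Num.min (g x) (h x)); first exact: trig_limit_min.
by apply/seteqP; split => x /=; rewrite lt_min => /andP.
Qed.

(** The sets [cos_ball q] form a countable base, so each open set is a countable union of members of
    [trig_pos]. *)
Lemma measurable_torusE : @measurable _ T = <<s trig_pos >>.
Proof.
apply/seteqP; split; last first.
  apply: smallest_sub; first exact: sigma_algebra_measurable.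
  by move=> A /trig_pos_open oA; exact: (@sub_sigma_algebra _ setT (@open T)).
apply: smallest_sub; first exact: smallest_sigma_algebra.
move=> U oU.
have -> : U = \bigcup_q (if `[< cos_ball q `<=` U >] then cos_ball q else set0).
  apply/seteqP; split=> [x Ux|x [q _]].
    have [q xq qU] := cos_ball_basis oU Ux; exists q => //.
    by case: asboolP.
  by case: asboolP => // qU /qU.
apply: (@countable_bigcupT_measurable _ (g_sigma_algebraType trig_pos)).
  exact: countableP.
move=> q; case: asboolP => // _; apply: sub_sigma_algebra.
by have [g lg ->] := cos_ball_trig q; exists g.
Qed.

End trigonometric_polynomials.

(** * Density in L^2 *)

Section square_integrals.
Local Open Scope ereal_scope.
Context {dd : measure_display} {X : measurableType dd} {R : realType}.
Variable m : {measure set X -> \bar R}.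
Implicit Types f g : X -> R.

Definition sqint f : \bar R := \int[m]_x (f x ^+ 2)%:E.

Lemma measurable_sqr f : measurable_fun setT f -> measurable_fun setT (fun x => (f x ^+ 2)%:E).
Proof. by move=> mf; apply/measurable_EFinP; exact: measurable_funX. Qed.

Lemma sqint_ge0 f : 0 <= sqint f.
Proof. by apply: integral_ge0 => x _; rewrite lee_fin sqr_ge0. Qed.

Lemma sqintD f g : measurable_fun setT f -> measurable_fun setT g ->
  sqint (fun x => f x + g x)%R <= 2%:E * sqint f + 2%:E * sqint g.
Proof.
move=> mf mg; rewrite /sqint -!ge0_integralZl//; last 4 first.
- exact: measurable_sqr.
- by move=> x _; rewrite lee_fin sqr_ge0.
- exact: measurable_sqr.
- by move=> x _; rewrite lee_fin sqr_ge0.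
have m2 (h : X -> R) : measurable_fun setT h ->
    measurable_fun setT (fun x => 2%:E * (h x ^+ 2)%:E : \bar R).
  by move=> mh; apply: emeasurable_funM; [exact: measurable_cst|exact: measurable_sqr].
rewrite -ge0_integralD//; last 4 first.
- by move=> x _; rewrite -EFinM lee_fin mulr_ge0// sqr_ge0.
- exact: m2.
- by move=> x _; rewrite -EFinM lee_fin mulr_ge0// sqr_ge0.
- exact: m2.
apply: ge0_le_integral => //.
- by move=> x _; rewrite lee_fin sqr_ge0.
- by apply: measurable_sqr; exact: measurable_funD.
- by apply: emeasurable_funD; exact: m2.
- move=> x _; rewrite -!EFinM -EFinD lee_fin.
  by have := sqr_ge0 (f x - g x)%R; nra.
Qed.

Lemma sqintZ (c : R) f : measurable_fun setT f ->
  sqint (fun x => c * f x)%R = (c ^+ 2)%:E * sqint f.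
Proof.
move=> mf; rewrite /sqint -ge0_integralZl//; last 3 first.
- exact: measurable_sqr.
- by move=> x _; rewrite lee_fin sqr_ge0.
- by rewrite lee_fin sqr_ge0.
by apply: eq_integral => x _; rewrite -EFinM exprMn.
Qed.

Lemma sqint_dominated (f_ : nat -> X -> R) f (g : X -> R) :
  (forall n, measurable_fun setT (f_ n)) -> measurable_fun setT f ->
  (forall x, f_ n x @[n --> \oo] --> f x) ->
  m.-integrable setT (EFin \o g) ->
  (forall n x, ((f x - f_ n x) ^+ 2 <= g x)%R) ->
  sqint (fun x => f x - f_ n x)%R @[n --> \oo] --> 0.
Proof.
move=> mf_ mf ff ig fg.
have mB n : measurable_fun setT (fun x => ((f x - f_ n x) ^+ 2)%:E).
  by apply: measurable_sqr; exact: measurable_funB.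
have [] := @dominated_convergence _ _ _ m setT measurableT
  (fun n x => ((f x - f_ n x) ^+ 2)%:E) (fun=> 0) (EFin \o g) mB (measurable_cst 0).
- apply/nearW => x _; apply: cvg_EFin; first exact: nearW.
  have cB : (f x - f_ n x)%R @[n --> \oo] --> 0%R.
    by rewrite -[X in _ --> X](subrr (f x)); apply: cvgB; [exact: cvg_cst|exact: ff].
  rewrite (_ : _ \o _ = (fun n => (f x - f_ n x) * (f x - f_ n x))%R); last first.
    by apply/funext => n; rewrite /= expr2.
  by rewrite -[X in _ --> X](mulr0 (0 : R)%R); exact: cvgM.
- exact: ig.
- by apply/nearW => x n _; rewrite gee0_abs ?lee_fin ?sqr_ge0//=; exact: fg.
- by move=> _ _; rewrite integral0.
Qed.

End square_integrals.

Section L2_density.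
Import HBNNSimple.
Context {R : realType} {d : nat}.
Local Notation T := (torus R d).
Variable m : {measure set T -> \bar R}.
Hypothesis m_fin : (m setT < +oo)%E.
Implicit Types f g : T -> R.

Lemma trig_limit_measurable f : trig_limit f -> measurable_fun setT f.
Proof. by move=> /trig_limit_continuous; exact: continuous_measurable_torus. Qed.

(** The finite measure [m] is kept general: it will be dx, to approximate the eigenfunctions, and dx
    + mu, to approximate the indicator of a null set. *)
Definition L2_approximable f := measurable_fun setT f /\
  forall e : R, 0 < e -> exists2 a, trig_limit a & (sqint m (fun x => f x - a x)%R <= e%:E)%E.

Lemma L2_approximable_trig f : trig_limit f -> L2_approximable f.
Proof.
move=> lf; split; first exact: trig_limit_measurable.
move=> e e0; exists f => //; rewrite /sqint integral0_eq ?lee_fin ?ltW// => x _.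
by rewrite subrr expr0n.
Qed.

Lemma L2_approximable_near f : measurable_fun setT f ->
  (forall e : R, 0 < e -> exists2 g, L2_approximable g &
     (sqint m (fun x => f x - g x)%R <= e%:E)%E) -> L2_approximable f.
Proof.
(* The quarter comes from (a + b)^2 <= 2 a^2 + 2 b^2, which replaces the triangle inequality
   throughout. *)
move=> mf H; split => // e e0; have e4 : 0 < e / 4 by rewrite divr_gt0.
have [g [mg ag] fg] := H _ e4; have [a la ga] := ag _ e4; exists a => //.
have ma := trig_limit_measurable la.
rewrite (_ : (fun x => f x - a x) = (fun x => (f x - g x) + (g x - a x))); last first.
  by apply/funext => x; rewrite addrA subrK.
apply: (le_trans (sqintD m _ _)); [exact: measurable_funB|exact: measurable_funB|].
apply: (@le_trans _ _ (2%:E * (e / 4)%:E + 2%:E * (e / 4)%:E)%E).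
  by apply: leeD; apply: lee_wpmul2l.
by rewrite -!EFinM -EFinD lee_fin; lra.
Qed.

Lemma L2_approximableD f g : L2_approximable f -> L2_approximable g ->
  L2_approximable (fun x => f x + g x).
Proof.
move=> [mf af] [mg ag]; split; first exact: measurable_funD.
move=> e e0; have e4 : 0 < e / 4 by rewrite divr_gt0.
have [a la fa] := af _ e4; have [b lb gb] := ag _ e4.
exists (fun x => a x + b x); first exact: trig_limitD.
rewrite (_ : (fun x => f x + g x - (a x + b x)) =
  (fun x => (f x - a x) + (g x - b x))); last first.
  by apply/funext => x; rewrite opprD addrACA.
have [ma mb] := (trig_limit_measurable la, trig_limit_measurable lb).
apply: (le_trans (sqintD m _ _)); [exact: measurable_funB|exact: measurable_funB|].
apply: (@le_trans _ _ (2%:E * (e / 4)%:E + 2%:E * (e / 4)%:E)%E).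
  by apply: leeD; apply: lee_wpmul2l.
by rewrite -!EFinM -EFinD lee_fin; lra.
Qed.

Lemma L2_approximableZ (c : R) f : L2_approximable f ->
  L2_approximable (fun x => c * f x).
Proof.
move=> [mf af]; split; first by apply: measurable_funM => //; exact: measurable_cst.
move=> e e0; have c1 : 0 < c ^+ 2 + 1 by rewrite ltr_wpDl// sqr_ge0.
have ec : 0 < e / (c ^+ 2 + 1) by rewrite divr_gt0.
have [a la fa] := af _ ec; exists (fun x => c * a x); first exact: trig_limitZ.
under [X in sqint m X]eq_fun do rewrite -mulrBr.
rewrite sqintZ; last by apply: measurable_funB => //; exact: trig_limit_measurable.
apply: (@le_trans _ _ ((c ^+ 2)%:E * (e / (c ^+ 2 + 1))%:E)%E).
  by apply: lee_wpmul2l => //; rewrite lee_fin sqr_ge0.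
rewrite -EFinM lee_fin mulrCA ler_piMr ?(ltW e0)//.
by rewrite ler_pdivrMr// mul1r lerDl.
Qed.

Lemma L2_approximable_sum (I : Type) (r : seq I) (F : I -> T -> R) :
  (forall i, L2_approximable (F i)) -> L2_approximable (fun x => \sum_(i <- r) F i x).
Proof.
move=> aF; elim: r => [|i r IH].
  under eq_fun do rewrite big_nil; apply: L2_approximable_trig; exact: trig_limit_cst.
by under eq_fun do rewrite big_cons; exact: L2_approximableD.
Qed.

Lemma L2_approximable_lim (f_ : nat -> T -> R) f (g : T -> R) :
  (forall n, L2_approximable (f_ n)) -> measurable_fun setT f ->
  (forall x, f_ n x @[n --> \oo] --> f x) ->
  m.-integrable setT (EFin \o g) ->
  (forall n x, (f x - f_ n x) ^+ 2 <= g x) -> L2_approximable f.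
Proof.
move=> af mf ff ig fg; apply: L2_approximable_near => // e e0.
have mf_ n : measurable_fun setT (f_ n) by have [] := af n.
have := sqint_dominated mf_ mf ff ig fg.
move=> /fine_cvgP[fin /cvgrPdist_le/(_ _ e0) ce].
have [N _ NP] := filterI fin ce; have [finN] := NP N (leqnn N).
rewrite /= sub0r normrN => cN; exists (f_ N) => //.
rewrite -(fineK finN) lee_fin; apply: le_trans cN; exact: ler_norm.
Qed.

Lemma L2_approximable_indic (E : set T) : measurable E -> L2_approximable (\1_E : T -> R).
Proof.
have i4 : m.-integrable setT (EFin \o (fun=> 4 : R)).
  apply: measurable_bounded_integrable => //.
  by exists 4; split; [exact: num_real|move=> B B4 x _; rewrite /= ger0_norm// ltW].
have bnd (a b : R) : 0 <= a <= 1 -> 0 <= b <= 1 -> (a - b) ^+ 2 <= 4.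
  by move=> /andP[? ?] /andP[? ?]; nra.
have ind01 (A : set T) x : (0 : R) <= \1_A x <= 1.
   by rewrite indicE; case: (x \in A) => /=; apply/andP; split; rewrite ?ler01 ?lexx.
move=> mE; apply: (@dynkin_induction _ T trig_pos
  (fun E => L2_approximable (\1_E : T -> R)) measurable_torusE trig_pos_setI).
- by rewrite indicT; apply: L2_approximable_trig; exact: trig_limit_cst.
- move=> A tA; have oA := trig_pos_open tA; have mA : measurable A.
    exact: (@sub_sigma_algebra _ setT (@open T)).
  move: tA => [g lg Ag].
  (* This vanishes off [A], and at a point of [A] it equals 1 as soon as n >= 1 / g x. *)
  pose f_ n x := Num.min 1 (n%:R * Num.max (g x) 0).
  apply: (@L2_approximable_lim f_ _ (fun=> 4)) => //.
  + move=> n; apply: L2_approximable_trig; apply: trig_limit_min; first exact: trig_limit_cst.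
    by apply: trig_limitZ; apply: trig_limit_max => //; exact: trig_limit_cst.
  + move=> x; rewrite indicE; have [xA|xA] := boolP (x \in A).
      have g0 : 0 < g x by move: xA; rewrite inE Ag.
      apply: (@cvg_near_cst _ _ _ _ _ eventually_filter).
      exists (Num.truncn (g x)^-1).+1 => // n /= nN.
      rewrite /f_ (max_l (ltW g0)); apply/min_idPl.
      rewrite -ler_pdivrMr// div1r (le_trans (ltW (truncnS_gt _)))// ler_nat//.
    have g0 : g x <= 0 by move: xA; rewrite notin_setE Ag /= => /negP; rewrite -leNgt.
    rewrite (_ : f_ ^~ x = fun=> 0); first exact: cvg_cst.
    by apply/funext => n; rewrite /f_ (max_r g0) mulr0; apply/min_idPr.
  + move=> n x; apply: bnd; first exact: ind01.
    rewrite /f_ ge_min lexx/= andbT.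
    by rewrite le_min ler01 mulr_ge0// le_max lexx orbT.
- move=> A mA aA.
  rewrite (_ : \1_(~` A) = (fun x => 1 + (-1) * \1_A x)).
    apply: L2_approximableD; last exact: L2_approximableZ.
    by apply: L2_approximable_trig; exact: trig_limit_cst.
  apply/funext => x; rewrite !indicE in_setC.
  by case: (x \in A); rewrite /= ?mulr1 ?mulr0 ?subrr ?addr0.
- move=> F mF tF aF.
  (* Disjointness turns the partial sums into indicators, so a constant dominates them all. *)
  have Sle n x : \sum_(i < n) (\1_(F i) x : R) = \1_(\big[setU/set0]_(i < n) F i) x.
    elim: n => [|n IH]; first by rewrite !big_ord0 indicE in_set0.
    rewrite !big_ord_recr/= IH !indicE in_setU.
    have [xF|xF] := boolP (x \in F n); last by rewrite orbF addr0.
    rewrite orbT; have -> : x \in \big[setU/set0]_(i < n) F i = false; last by rewrite add0r.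
    apply/negbTE; rewrite notin_setE -bigcup_mkord => -[i /= ltin Fix].
    have := trivIsetP.1 tF i n I I; rewrite neq_ltn ltin => /(_ isT).
    by move=> /seteqP[+ _] => /(_ x); apply; split => //; exact: set_mem.
  apply: (@L2_approximable_lim (fun n x => \sum_(i < n) \1_(F i) x) _ (fun=> 4)) => //.
  + by move=> n; apply: L2_approximable_sum => i; exact: aF.
  + apply: measurable_indic; exact: bigcupT_measurable.
  + move=> x; under eq_fun do rewrite Sle.
    have [[n _ Fnx]|xF] := pselect ((\bigcup_k F k) x).
      apply: (@cvg_near_cst _ _ _ _ _ eventually_filter); exists n.+1 => // p /= np.
      rewrite !indicE !mem_set//; first by exists n.
      by rewrite -bigcup_mkord; exists n.
    rewrite (_ : (fun n => _) = fun=> \1_(\bigcup_k F k) x); first exact: cvg_cst.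
    apply/funext => n; rewrite !indicE !memNset//.
    by rewrite -bigcup_mkord => -[i _ Fix]; apply: xF; exists i.
  + by move=> n x; rewrite Sle; apply: bnd; exact: ind01.
- by rewrite -measurable_torusE.
Qed.

Lemma L2_approximable_sqint f : measurable_fun setT f -> (sqint m f < +oo)%E ->
  L2_approximable f.
Proof.
suff pos g : (forall x, 0 <= g x) -> measurable_fun setT g -> (sqint m g < +oo)%E ->
    L2_approximable g.
  move=> mf sf.
  have part (s : R) : s ^+ 2 = 1 -> L2_approximable (fun x => Num.max (s * f x) 0).
    move=> s1; apply: pos.
    - by move=> x; rewrite le_max lexx orbT.
    - apply: measurable_maxr; last exact: measurable_cst.
      by apply: measurable_funM => //; exact: measurable_cst.
    - apply: le_lt_trans sf; apply: ge0_le_integral => //.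
      + by move=> x _; rewrite lee_fin sqr_ge0.
      + apply: measurable_sqr; apply: measurable_maxr; last exact: measurable_cst.
        by apply: measurable_funM => //; exact: measurable_cst.
      + exact: measurable_sqr.
      + move=> x _; rewrite lee_fin; case: (leP (s * f x) 0) => _.
          by rewrite expr0n sqr_ge0.
        by rewrite exprMn s1 mul1r.
  rewrite (_ : f = fun x => Num.max (1 * f x) 0 + (-1) * Num.max (-1 * f x) 0).
    apply: L2_approximableD; first by apply: part; rewrite expr1n.
    by apply: L2_approximableZ; apply: part; rewrite sqrrN expr1n.
  apply/funext => x; rewrite mul1r !mulN1r.
  by case: (leP (f x) 0) => f0; case: (leP (- f x) 0) => f0'; lra.
move=> g0 mg sg; have mgE : measurable_fun setT (EFin \o g) by exact/measurable_EFinP.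
have g0E x : [set: T] x -> (0 <= (EFin \o g) x)%E by rewrite lee_fin.
pose f_ n : T -> R := nnsfun_approx measurableT mgE n.
have cf x : f_ n x @[n --> \oo] --> g x.
  have /= := @cvg_approx _ T R setT (EFin \o g) x g0E I (ltry _).
  by under eq_fun do rewrite -(nnsfun_approxE measurableT mgE).
have f_nd n p x : (n <= p)%N -> f_ n x <= f_ p x.
  by move=> np; have /lefP := nd_nnsfun_approx measurableT mgE np; exact.
have f_le n x : 0 <= f_ n x <= g x.
  rewrite fun_ge0/=; have := cvg_lim (@Rhausdorff R) (cf x) => <-.
  apply: nondecreasing_cvgn_le; last by apply/cvg_ex; exists (g x).
  by move=> p q pq; exact: f_nd.
apply: (@L2_approximable_lim f_ _ (fun x => g x ^+ 2)) => //.
- move=> n; rewrite /f_; move: (nnsfun_approx _ _ _) => s.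
  rewrite (_ : (s : T -> R) = fun x =>
      \sum_(y <- finmap.enum_fset (fset_set (range s))) y * \1_(s @^-1` [set y]) x).
    apply: L2_approximable_sum => y; apply: L2_approximableZ.
    exact: L2_approximable_indic.
  by apply/funext => x; rewrite {1}(fimfunE s x) fsbig_finite.
- apply/integrableP; split; first exact: measurable_sqr.
  rewrite (eq_integral (fun x => (g x ^+ 2)%:E))//.
  by move=> x _; rewrite /= ger0_norm// sqr_ge0.
- by move=> n x; have /andP[? ?] := f_le n x; nra.
Qed.

End L2_density.

(** * Trigonometric sums with frequencies in a level set *)

Section torus_forms.
Context {R : realType} {d : nat}.
Local Notation T := (torus R d).
Local Notation dx := (lebesgue_torus R d).
Local Notation Z := 'rV[int]_d.
Local Notation integrable f := (dx.-integrable setT (EFin \o f)).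
Implicit Types (f g : T -> R) (u v w p : T -> R[i]) (c : Z -> R[i]) (A B : seq Z).

Definition sqnorm (z : R[i]) : R := complex.Re z ^+ 2 + complex.Im z ^+ 2.

Lemma sqnorm_ge0 z : 0 <= sqnorm z.
Proof. by rewrite addr_ge0// sqr_ge0. Qed.

Lemma sqnormM z z' : sqnorm (z * z') = sqnorm z * sqnorm z'.
Proof. by case: z z' => [a b] [a' b']; rewrite /sqnorm /=; ring. Qed.

Lemma sqnormD z z' :
  sqnorm (z + z') = sqnorm z + sqnorm z' + 2 * complex.Re (z * z'^*%C).
Proof. by case: z z' => [a b] [a' b']; rewrite /sqnorm /=; ring. Qed.

Lemma sqnormD_le z z' : sqnorm (z + z') <= 2 * sqnorm z + 2 * sqnorm z'.
Proof.
case: z z' => [a b] [a' b']; rewrite /sqnorm /=.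
by have := sqr_ge0 (a - a'); have := sqr_ge0 (b - b'); nra.
Qed.

Lemma sqnorm_expi k (x : T) : sqnorm (expi k x) = 1.
Proof. by rewrite /sqnorm /expi /=; exact: cos2Dsin2. Qed.

Lemma modulus_sqr z : modulus z ^+ 2 = sqnorm z.
Proof. by case: z => a b; rewrite /modulus /= sqr_sqrtr// addr_ge0// sqr_ge0. Qed.

Lemma sqnorm_sum (I : Type) (r : seq I) (F : I -> R[i]) :
  sqnorm (\sum_(i <- r) F i) <= (size r)%:R * \sum_(i <- r) sqnorm (F i).
Proof.
elim: r => [|i r IH]; first by rewrite !big_nil /sqnorm /= expr0n addr0 mul0r.
rewrite !big_cons /=; move: IH; set z := \sum_(j <- r) F j.
set q := \sum_(j <- r) sqnorm (F j).
have q0 : 0 <= q by apply: sumr_ge0 => j _; exact: sqnorm_ge0.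
rewrite -natr1; move: (size r) => n.
case: n => [|n] IH.
  have /eqP : sqnorm z == 0 by rewrite eq_le sqnorm_ge0 andbT (le_trans IH)// mul0r.
  rewrite /sqnorm => /eqP; rewrite paddr_eq0 ?sqr_ge0// !sqrf_eq0 => /andP[/eqP z1 /eqP z2].
  have -> : z = 0 by apply/eqP; rewrite eq_complex z1 z2 !eqxx.
  by rewrite add0r mul1r addr0 lerDl.
have n0 : 0 < n.+1%:R :> R by [].
move: (n.+1%:R) n0 IH => N n0 IH.
(* The inequality N |a + z|^2 <= N (N + 1) |a|^2 + (N + 1) |z|^2 is |N a - z|^2 >= 0 rearranged;
   then |z|^2 <= N q is inserted. *)
have : N * (sqnorm (F i + z)) <= N * ((N + 1) * (sqnorm (F i) + q)).
  apply: (@le_trans _ _ (N * (N + 1) * sqnorm (F i) + (N + 1) * sqnorm z)).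
    case: (F i) (z) => [a b] [a' b']; rewrite /sqnorm /=.
    by have := sqr_ge0 (N * a - a'); have := sqr_ge0 (N * b - b'); nra.
  have N1 : 0 <= N + 1 by rewrite addr_ge0// ltW.
  by have := ler_wpM2l N1 IH; lra.
by rewrite ler_pM2l.
Qed.

Lemma lebesgue_torus_lty : (dx setT < +oo)%E.
Proof. by rewrite lebesgue_torusT ltry. Qed.

Lemma continuous_bounded_integrable f : continuous f ->
  (exists B : R, forall x, `|f x| <= B) -> integrable f.
Proof.
move=> cf [B fB]; apply: measurable_bounded_integrable => //.
- exact: lebesgue_torus_lty.
- exact: continuous_measurable_torus.
- by exists B; split; [exact: num_real|move=> C BC x _; rewrite /= (le_trans (fB x))// ltW].
Qed.

(** Only real parts are followed, because the cross terms of |z + z'|^2 enter through 2 Re. *)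
Definition mean0 (v : T -> R[i]) :=
  integrable (fun x => complex.Re (v x)) /\ \int[dx]_x complex.Re (v x) = 0.

Lemma mean0D v w : mean0 v -> mean0 w -> mean0 (fun x => v x + w x).
Proof.
have E x : complex.Re (v x + w x) = complex.Re (v x) + complex.Re (w x).
  by case: (v x) (w x) => [? ?] [? ?].
move=> [iv v0] [iw w0]; split.
  apply: eq_integrable (integrableD measurableT iv iw) => // x _ /=.
  by rewrite E EFinD.
under eq_Rintegral do rewrite E.
by rewrite RintegralD// v0 w0 addr0.
Qed.

Lemma mean0_sum (I : eqType) (r : seq I) (F : I -> T -> R[i]) :
  (forall i, i \in r -> mean0 (F i)) -> mean0 (fun x => \sum_(i <- r) F i x).
Proof.
elim: r => [_|i r IH Fr].
  split.
    by apply: eq_integrable (integrable0 dx setT) => // x _; rewrite /= big_nil.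
  rewrite (@eq_Rintegral _ _ _ _ _ (fun=> 0)); first by rewrite Rintegral_cst// mul0r.
  by move=> x _; rewrite big_nil.
rewrite (_ : (fun x => _) = (fun x => F i x + \sum_(j <- r) F j x)); last first.
  by apply/funext => x; rewrite big_cons.
apply: mean0D; first by apply: Fr; exact: mem_head.
by apply: IH => j jr; apply: Fr; rewrite inE jr orbT.
Qed.

Lemma mean0_Re_Im (c : R[i]) v :
  integrable (fun x => complex.Re (v x)) -> integrable (fun x => complex.Im (v x)) ->
  \int[dx]_x complex.Re (v x) = 0 -> \int[dx]_x complex.Im (v x) = 0 ->
  mean0 (fun x => c * v x).
Proof.
move=> iR iI R0 I0.
have E x : complex.Re (c * v x) =
    complex.Re c * complex.Re (v x) - complex.Im c * complex.Im (v x).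
  by case: (c) (v x) => [? ?] [? ?].
have iZ a f : integrable f -> integrable (fun x => a * f x).
  by move=> jf; apply: eq_integrable (integrableZl measurableT a jf).
split.
  apply: eq_integrable (integrableB measurableT
    (iZ (complex.Re c) _ iR) (iZ (complex.Im c) _ iI)) => // x _ /=.
  by rewrite E EFinB.
under eq_Rintegral do rewrite E.
rewrite RintegralB//; [|exact: iZ|exact: iZ].
by rewrite !RintegralZl// R0 I0 !mulr0 subrr.
Qed.

Lemma mean0_expi (c : R[i]) (k : Z) : k != 0 -> mean0 (fun x => c * expi k x).
Proof.
move=> k0.
have bR : exists B : R, forall x : T, `|complex.Re (expi k x)| <= B.
  by exists 1 => x; exact: cos_max.
have bI : exists B : R, forall x : T, `|complex.Im (expi k x)| <= B.
  by exists 1 => x; exact: sin_max.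
apply: mean0_Re_Im.
- apply: continuous_bounded_integrable => //; exact: continuous_Re_expi.
- apply: continuous_bounded_integrable => //; exact: continuous_Im_expi.
- transitivity (fine (\int[dx]_x (cos (angle k (repr x) + 0))%:E)); last first.
    by rewrite lebesgue_torus_integral_cos.
  by congr fine; apply: eq_integral => x _; rewrite addr0.
- transitivity (fine (\int[dx]_x (cos (angle k (repr x) + - (pi / 2)))%:E)); last first.
    by rewrite lebesgue_torus_integral_cos.
  by congr fine; apply: eq_integral => x _; rewrite cosBpihalf.
Qed.

(** Unlike in [trigpoly], the coefficients are a function on all frequencies, so that the list [A]
    can be cut into clusters with [c] fixed. *)
Definition trigsum c A (x : T) : R[i] := \sum_(k <- A) c k * expi k x.

Lemma trigsumE c A : trigsum c A = trigpoly [seq (k, c k) | k <- A].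
Proof. by apply/funext => x; rewrite /trigpoly big_map. Qed.

Definition tame v := [/\ continuous (fun x => complex.Re (v x)),
  continuous (fun x => complex.Im (v x)) &
  exists B : R, forall x, `|complex.Re (v x)| <= B /\ `|complex.Im (v x)| <= B].

Lemma trigsum_tame c A : tame (trigsum c A).
Proof. by rewrite trigsumE; exact: trigpoly_continuous_bounded. Qed.

Lemma sqnorm_tame v : tame v -> continuous (fun x => sqnorm (v x)) /\
  exists B : R, forall x, `|sqnorm (v x)| <= B.
Proof.
move=> [cR cI [B BP]]; split.
  move=> x; apply: (@continuousD _ _ _ (fun x => complex.Re (v x) ^+ 2)).
    by apply: (@continuousM _ _ (fun x => complex.Re (v x))); exact: cR.
  by apply: (@continuousM _ _ (fun x => complex.Im (v x))); exact: cI.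
exists (B ^+ 2 + B ^+ 2) => x; have [B1 B2] := BP x.
rewrite ger0_norm ?sqnorm_ge0// /sqnorm lerD//.
  by rewrite -real_normK ?num_real// lerXn2r ?nnegrE// (le_trans _ B1).
by rewrite -[complex.Im _ ^+ 2]real_normK ?num_real// lerXn2r ?nnegrE// (le_trans _ B2).
Qed.

Lemma trig_form_integrable f v : real_trig f -> tame v ->
  integrable (fun x => f x * sqnorm (v x)).
Proof.
move=> tf /sqnorm_tame[cv [B BP]]; apply: continuous_bounded_integrable.
  move=> x; apply: (@continuousM _ _ f (fun x => sqnorm (v x))); last exact: cv.
  exact: real_trig_continuous.
have [B' B'P] := real_trig_bounded tf; exists (B' * B) => x.
by rewrite normrM ler_pM.
Qed.

Definition trig_form f c A : R := \int[dx]_x (f x * sqnorm (trigsum c A x)).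

(** Every cross term is a multiple of some e^{i(p+k-l).x} with nonzero frequency, which integrates
    to 0. *)
Lemma trig_form_cat f (s : seq (Z * R[i])) c A B :
  (forall x, (f x)%:C%C = trigpoly s x) ->
  (forall (p : Z * R[i]) k l, p \in s -> k \in A -> l \in B -> p.1 + (k - l) != 0) ->
  trig_form f c (A ++ B) = trig_form f c A + trig_form f c B.
Proof.
move=> fs sAB; have tf : real_trig f by exists s.
pose W x := trigpoly s x * (trigsum c A x * (trigsum c B x)^*%C).
have E x : f x * sqnorm (trigsum c (A ++ B) x) =
    f x * sqnorm (trigsum c A x) + f x * sqnorm (trigsum c B x) + 2 * complex.Re (W x).
  rewrite {1}/trigsum big_cat/= -!/(trigsum c _ x) sqnormD.
  have -> : complex.Re (W x) = f x * complex.Re (trigsum c A x * (trigsum c B x)^*%C).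
    rewrite /W -fs; move: (trigsum c A x * _) => -[a b] /=.
    by rewrite mul0r subr0.
  by ring.
have [iW W0] : mean0 W.
  rewrite (_ : W = fun x => \sum_(p <- s) \sum_(k <- A) \sum_(l <- B)
      (p.2 * (c k * (c l)^*%C)) * expi (p.1 + (k - l)) x).
    apply: mean0_sum => p ps; apply: mean0_sum => k kA; apply: mean0_sum => l lB.
    by apply: mean0_expi; exact: sAB.
  apply/funext => x; rewrite /W /trigpoly mulr_suml; apply: eq_bigr => p _.
  rewrite /trigsum mulr_suml mulr_sumr; apply: eq_bigr => k _.
  rewrite rmorph_sum/= !mulr_sumr; apply: eq_bigr => l _.
  have -> : (c l * expi l x)^*%C = (c l)^*%C * expi (- l) x.
    by rewrite -conj_expi; exact: rmorphM.
  by rewrite !expiD; ring.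
rewrite /trig_form; under eq_Rintegral do rewrite E.
have [iA iB] := (trig_form_integrable tf (trigsum_tame c A), trig_form_integrable tf (trigsum_tame c B)).
rewrite RintegralD//=; last 2 first.
- by apply: eq_integrable (integrableD measurableT iA iB).
- by apply: eq_integrable (integrableZl measurableT 2 iW).
by rewrite RintegralD// RintegralZl// W0 mulr0 addr0.
Qed.

Lemma trig_form1 c A : uniq A ->
  trig_form (fun=> 1) c A = (2 * pi) ^+ d * \sum_(k <- A) sqnorm (c k).
Proof.
have tr1 (x : T) : ((fun=> 1) x)%:C%C = trigpoly [:: (0, 1)] x :> R[i].
  by rewrite /trigpoly big_seq1/= expi0 mulr1.
elim: A => [_|k A IH /= /andP[kA uA]].
  rewrite /trig_form /trigsum; under eq_Rintegral do rewrite big_nil /sqnorm /= expr0n addr0 mulr0.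
  by rewrite Rintegral_cst// mul0r big_nil mulr0.
rewrite -cat1s (trig_form_cat c tr1); last first.
  move=> p k' l; rewrite !inE => /eqP -> /eqP -> lA /=; rewrite add0r subr_eq0.
  by apply: contra kA => /eqP ->.
have Ek : trig_form (fun=> 1) c [:: k] = (2 * pi) ^+ d * sqnorm (c k).
  rewrite /trig_form /trigsum.
  under eq_Rintegral do rewrite big_seq1 sqnormM sqnorm_expi mulr1 mul1r.
  rewrite Rintegral_cst// [LHS]mulrC; congr (_ * _).
  exact: (congr1 fine lebesgue_torusT).
by rewrite Ek IH// -mulrDr cat1s big_cons.
Qed.

Lemma trig_form_le f g c A : real_trig f -> real_trig g -> (forall x, f x <= g x) ->
  trig_form f c A <= trig_form g c A.
Proof.
move=> tf tg fg; apply: le_Rintegral => //; [exact: trig_form_integrable (trigsum_tame _ _)|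
  exact: trig_form_integrable (trigsum_tame _ _)|].
by move=> x _; rewrite ler_wpM2r ?sqnorm_ge0.
Qed.

(** Cauchy-Schwarz at each point: all characters have modulus 1, so the squared sum is at most
    [size A] times the sum of the |c_k|^2, and only f is left to integrate. *)
Lemma trig_form_size f c A : real_trig f -> (forall x, 0 <= f x) ->
  trig_form f c A <= (size A)%:R * (\int[dx]_x f x) * \sum_(k <- A) sqnorm (c k).
Proof.
move=> tf f0.
have itf : integrable f.
  by apply: continuous_bounded_integrable; [exact: real_trig_continuous|exact: real_trig_bounded].
rewrite mulrAC -RintegralZl//; apply: le_Rintegral => //.
- exact: trig_form_integrable (trigsum_tame _ _).
- by apply: eq_integrable (integrableZl measurableT _ itf).
- move=> x _; rewrite mulrC ler_wpM2r//.
  rewrite (le_trans (sqnorm_sum _ _))// ler_wpM2l// ler_sum// => k _.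
  by rewrite sqnormM sqnorm_expi mulr1.
Qed.

Lemma pinched_trigsum_small (t : nat -> T -> R) :
  (forall i, real_trig (t i)) -> (forall i x, 0 <= t i x) ->
  (forall i x, t i.+1 x <= t i x) -> \int[dx]_x t n x @[n --> \oo] --> 0 ->
  forall a C eta : R, 0 < a -> 0 <= C -> 0 < eta -> exists i, forall S, @pinched R d a C S ->
  forall A c, uniq A -> [set` A] `<=` S -> trig_form (t i) c A <= eta * trig_form (fun=> 1) c A.
Proof.
move=> tr t0 tdecr tlim a C eta a0 C0 eta0.
have V0 : 0 < (2 * pi) ^+ d :> R by rewrite exprn_gt0// mulr_gt0// pi_gt0.
have F_perm j c A B : perm_eq A B -> trig_form (t j) c A = trig_form (t j) c B.
  move=> pAB; rewrite /trig_form; apply: eq_Rintegral => x _.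
  by rewrite /trigsum (perm_big _ pAB).
have F_sep j : exists N, forall c A B, uniq (A ++ B) -> @far_apart R d N A B ->
    trig_form (t j) c (A ++ B) <= trig_form (t j) c A + trig_form (t j) c B.
  have [s sP] := tr j.
  (* The sum of the truncated norms, plus one, bounds every frequency of t_j. Hence no p in [s] can
     bridge a gap larger than this. *)
  exists (\sum_(p <- s) Num.truncn `|int_row p.1 : 'rV[R]_d|).+1 => c A B uAB sAB.
  rewrite (trig_form_cat c sP)// => p k l ps kA lB.
  have := sAB k l kA lB; apply: contraTneq => E.
  move/eqP: E; rewrite addr_eq0 opprB -leNgt => /eqP <-.
  rewrite (le_trans (ltW (truncnS_gt _)))// ler_nat ltnS.
  by rewrite (big_rem p)//= leq_addr.
have [i iP] := @pinched_forms_small R d _ (fun c k => sqnorm (c k))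
   (fun i c A => trig_form (t i) c A)
  (fun i => \int[dx]_x t i x) (fun c k => sqnorm_ge0 (c k))
  (fun i c A => trig_form_le c A (tr i.+1) (tr i) (tdecr i)) F_perm F_sep
  (fun i c A => trig_form_size c A (tr i) (t0 i)) tlim a C
   (eta * (2 * pi) ^+ d) a0 C0 (mulr_gt0 eta0 V0).
exists i => S pS A c uA AS; rewrite trig_form1// [leRHS]mulrA; exact: (iP S pS).
Qed.

End torus_forms.

(** * Approximation in L^2 within the spectrum *)

Section projection.
Context {R : realType} {d : nat}.
Local Notation T := (torus R d).
Local Notation dx := (lebesgue_torus R d).
Local Notation Z := 'rV[int]_d.
Local Notation integrable f := (dx.-integrable setT (EFin \o f)).
Implicit Types (f g : T -> R) (u v w : T -> R[i]) (c : Z -> R[i]) (A B : seq Z).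

Definition nsq u : \bar R := (\int[dx]_x (sqnorm (u x))%:E)%E.

Definition square_integrable u := measurable_cfun u /\ (nsq u < +oo)%E.

Lemma measurable_sqnorm u : measurable_cfun u -> measurable_fun setT (fun x => sqnorm (u x)).
Proof. by move=> [mR mI]; apply: measurable_funD; exact: measurable_funX. Qed.

Lemma L2norm_sqr u : (L2norm u `^ 2)%E = nsq u.
Proof.
rewrite /L2norm poweR_Lnorm//; apply: eq_integral => x _.
have m0 : 0 <= modulus (u x) by rewrite /modulus; case: (u x) => a b; exact: sqrtr_ge0.
by rewrite gee0_abs ?lee_fin// poweR_EFin powR_mulrn// modulus_sqr.
Qed.

Lemma in_L2_square_integrable u : in_L2 u -> square_integrable u.
Proof. by move=> [mu u2]; split => //; rewrite -L2norm_sqr poweR_lty. Qed.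

Lemma nsqE u : measurable_cfun u ->
  nsq u = (sqint dx (fun x => complex.Re (u x)) + sqint dx (fun x => complex.Im (u x)))%E.
Proof.
move=> [mR mI]; rewrite /sqint -ge0_integralD//.
- by move=> x _; rewrite lee_fin sqr_ge0.
- exact: measurable_sqr.
- by move=> x _; rewrite lee_fin sqr_ge0.
- exact: measurable_sqr.
Qed.

Lemma measurable_cfunD u v : measurable_cfun u -> measurable_cfun v ->
  measurable_cfun (fun x => u x + v x).
Proof.
move=> [uR uI] [vR vI]; split.
  apply: eq_measurable_fun (measurable_funD uR vR) => x _ /=.
  by case: (u x) (v x) => [? ?] [? ?].
apply: eq_measurable_fun (measurable_funD uI vI) => x _ /=.
by case: (u x) (v x) => [? ?] [? ?].
Qed.

Lemma nsqD u v : measurable_cfun u -> measurable_cfun v ->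
  (nsq (fun x => u x + v x)%R <= 2%:E * nsq u + 2%:E * nsq v)%E.
Proof.
move=> mu mv; have muv := measurable_cfunD mu mv.
have m2 w : measurable_cfun w ->
    measurable_fun setT (fun x => (2%:E * (sqnorm (w x))%:E)%E : \bar R).
  move=> mw; apply: emeasurable_funM; first exact: measurable_cst.
  by apply/measurable_EFinP; exact: measurable_sqnorm.
have p2 w : forall x, [set: T] x -> (0 <= (2%:E * (sqnorm (w x))%:E))%E.
  by move=> x _; rewrite -EFinM lee_fin mulr_ge0// sqnorm_ge0.
have pn w : forall x, [set: T] x -> (0 <= (sqnorm (w x))%:E)%E.
  by move=> x _; rewrite lee_fin sqnorm_ge0.
have mE w : measurable_cfun w -> measurable_fun setT (fun x => (sqnorm (w x))%:E).
  by move=> mw; apply/measurable_EFinP; exact: measurable_sqnorm.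
rewrite /nsq -!ge0_integralZl//; [|exact: mE|exact: pn|exact: mE|exact: pn].
rewrite -ge0_integralD//; [|exact: p2|exact: m2|exact: p2|exact: m2].
apply: ge0_le_integral => //; [exact: pn|exact: mE| |].
  by apply: emeasurable_funD; exact: m2.
by move=> x _; rewrite -!EFinM -EFinD lee_fin sqnormD_le.
Qed.

Lemma square_integrableD u v : square_integrable u -> square_integrable v ->
  square_integrable (fun x => u x + v x).
Proof.
move=> [mu u2] [mv v2]; split; first exact: measurable_cfunD.
by apply: le_lt_trans (nsqD mu mv) _; rewrite lte_add_pinfty// lte_mul_pinfty.
Qed.

Lemma square_integrable_sqnorm u : square_integrable u -> integrable (fun x => sqnorm (u x)).
Proof.
move=> [mu u2]; apply/integrableP; split.
  by apply/measurable_EFinP; exact: measurable_sqnorm.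
rewrite (eq_integral (fun x => (sqnorm (u x))%:E))//.
by move=> x _; rewrite /= ger0_norm// sqnorm_ge0.
Qed.

Lemma tame_square_integrable u : tame u -> square_integrable u.
Proof.
move=> tu; have [cs bs] := sqnorm_tame tu; have [cR cI _] := tu; split.
  by split; exact: continuous_measurable_torus.
have /integrableP[_] := continuous_bounded_integrable cs bs; apply: le_lt_trans.
apply: ge0_le_integral => //.
- by move=> x _; rewrite lee_fin sqnorm_ge0.
- by apply/measurable_EFinP; exact: continuous_measurable_torus.
- apply/measurable_EFinP; apply: measurableT_comp => //; exact: continuous_measurable_torus.
- by move=> x _; rewrite lee_fin ler_norm.
Qed.

Lemma square_integrable_sub_trigsum u c A : square_integrable u ->
  square_integrable (fun x => u x - trigsum c A x).
Proof.
move=> su; have -> : (fun x => u x - trigsum c A x) =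
    (fun x => u x + trigsum (fun k => - c k) A x).
  apply/funext => x; congr (_ + _); rewrite /trigsum -sumrN.
  by apply: eq_bigr => k _; rewrite mulNr.
apply: square_integrableD => //; apply: tame_square_integrable; exact: trigsum_tame.
Qed.

Lemma square_integrable_mul_expi u k : square_integrable u ->
  integrable (fun x => complex.Re (u x * (expi k x)^*%C)) /\
  integrable (fun x => complex.Im (u x * (expi k x)^*%C)).
Proof.
move=> su; have [[mR mI] _] := su.
have mc : measurable_fun setT (fun x : T => complex.Re (expi k x)).
  by apply: continuous_measurable_torus; exact: continuous_Re_expi.
have ms : measurable_fun setT (fun x : T => complex.Im (expi k x)).
  by apply: continuous_measurable_torus; exact: continuous_Im_expi.
have ig : integrable (fun x => 1 + sqnorm (u x)).
  have i1 : integrable (fun=> 1 : R).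
    apply: continuous_bounded_integrable; first exact: cst_continuous.
    by exists 1 => x; rewrite normr1.
  by apply: eq_integrable (integrableD measurableT i1 (square_integrable_sqnorm su)).
(* Both parts of u e^{-ik.x} are thus dominated by 1 + |u|^2, integrable because the torus has
   finite measure. *)
have key (a b p q : R) : p ^+ 2 + q ^+ 2 = 1 -> `|a * p + b * q| <= `|1 + (a ^+ 2 + b ^+ 2)|.
  move=> pq; rewrite [leRHS]ger0_norm; last by rewrite !addr_ge0// sqr_ge0.
  rewrite ler_norml; apply/andP; split.
    by have := sqr_ge0 (a + p); have := sqr_ge0 (b + q);
       have := sqr_ge0 a; have := sqr_ge0 b; nra.
  by have := sqr_ge0 (a - p); have := sqr_ge0 (b - q);
     have := sqr_ge0 a; have := sqr_ge0 b; nra.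
have cs1 x : complex.Re (expi k x) ^+ 2 + complex.Im (expi k x) ^+ 2 = 1 := sqnorm_expi k x.
have ER x : complex.Re (u x * (expi k x)^*%C) =
    complex.Re (u x) * complex.Re (expi k x) + complex.Im (u x) * complex.Im (expi k x).
  by case: (u x) (expi k x) => [a b] [p q] /=; rewrite mulrN opprK.
have EI x : complex.Im (u x * (expi k x)^*%C) =
    complex.Im (u x) * complex.Re (expi k x) + complex.Re (u x) * (- complex.Im (expi k x)).
  by case: (u x) (expi k x) => [a b] [p q] /=; rewrite addrC.
split; apply: le_integrable ig => //.
- apply/measurable_EFinP; apply: eq_measurable_fun (measurable_funD
    (measurable_funM mR mc) (measurable_funM mI ms)) => x _ /=.
  by rewrite ER.
- by move=> x _; rewrite /= lee_fin ER key.
- apply/measurable_EFinP; apply: eq_measurable_fun (measurable_funB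
    (measurable_funM mI mc) (measurable_funM mR ms)) => x _ /=.
  by rewrite EI mulrN.
- move=> x _; rewrite /= lee_fin EI /sqnorm [complex.Re _ ^+ 2 + _]addrC key//.
  by rewrite sqrrN.
Qed.

Lemma mean0_mul_expi u k (c : R[i]) : square_integrable u -> fourier_coef u k = 0 ->
  mean0 (fun x => c * (u x * (expi k x)^*%C)).
Proof.
move=> su /eqP; have [iR iI] := square_integrable_mul_expi k su.
rewrite /fourier_coef mulf_eq0 => /orP[|].
  rewrite eq_complex /= => /andP[+ _].
  by rewrite invr_eq0 expf_eq0 mulf_eq0 (gt_eqF (pi_gt0 R)) pnatr_eq0 andbF.
by rewrite eq_complex /= => /andP[/eqP R0 /eqP I0]; exact: mean0_Re_Im.
Qed.

Lemma trigpoly_trigsum s : exists A c, uniq A /\ @trigpoly R d s = trigsum c A.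
Proof.
exists (undup [seq p.1 | p <- s]), (fun k => \sum_(p <- s | p.1 == k) p.2).
split; first exact: undup_uniq.
apply/funext => x; rewrite /trigsum.
under eq_bigr do rewrite mulr_suml big_mkcond /=.
rewrite exchange_big /trigpoly big_seq [RHS]big_seq; apply: eq_bigr => p ps.
rewrite (bigD1_seq p.1) ?undup_uniq ?mem_undup ?map_f//= eqxx.
by rewrite big1 ?addr0// => k; rewrite eq_sym => /negbTE ->.
Qed.

Lemma sqint_real_trig f (e : R) : measurable_fun setT f -> (sqint dx f < +oo)%E ->
  0 < e -> exists2 g, real_trig g & (sqint dx (fun x => f x - g x)%R <= e%:E)%E.
Proof.
move=> mf f2 e0; have e4 : 0 < e / 4 by rewrite divr_gt0.
have [_ /(_ _ e4)[a la fa]] := L2_approximable_sqint lebesgue_torus_lty mf f2.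
set V : R := (2 * pi) ^+ d.
have V0 : 0 < V by rewrite exprn_gt0// mulr_gt0// pi_gt0.
(* With [del <= 1] the squared uniform error is at most [del], and its integral is at most
   [del * V <= e / 4]. *)
pose del := Num.min 1 (e / (4 * V)).
have del0 : 0 < del by rewrite lt_min ltr01 divr_gt0// mulr_gt0.
have [g tg ag] := la _ del0; exists g => //.
have [ma mg] := (trig_limit_measurable la, trig_limit_measurable (real_trig_limit tg)).
rewrite (_ : (fun x => f x - g x) = (fun x => (f x - a x) + (a x - g x))); last first.
  by apply/funext => x; rewrite addrA subrK.
apply: (le_trans (sqintD _ _ _)); [exact: measurable_funB|exact: measurable_funB|].
apply: (@le_trans _ _ (2%:E * (e / 4)%:E + 2%:E * (e / 4)%:E)%E); last first.
  by rewrite -!EFinM -EFinD lee_fin; lra.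
apply: leeD; apply: lee_wpmul2l => //.
apply: (@le_trans _ _ (\int[dx]_x (del ^+ 2)%:E)%E).
  apply: ge0_le_integral => //.
  - by move=> x _; rewrite lee_fin sqr_ge0.
  - by apply: measurable_sqr; exact: measurable_funB.
  - move=> x _; rewrite lee_fin -real_normK ?num_real//.
    by rewrite lerXn2r ?nnegrE ?(ltW del0).
have -> : (\int[dx]_x (del ^+ 2)%:E = (del ^+ 2)%:E * dx setT)%E by exact: integral_cst.
rewrite lebesgue_torusT -EFinM lee_fin -/V.
have d1 : del <= 1 by rewrite ge_min lexx.
have d2 : del <= e / (4 * V) by rewrite ge_min lexx orbT.
have -> : e / 4 = e / (4 * V) * V by field; rewrite gt_eqF.
rewrite ler_wpM2r ?(ltW V0)// (le_trans _ d2)// expr2 ler_piMr// ltW//.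
Qed.

Lemma trigsum_dense u (e : R) : square_integrable u -> 0 < e ->
  exists A c, uniq A /\ (nsq (fun x => u x - trigsum c A x)%R <= e%:E)%E.
Proof.
move=> su e0; have [mu u2] := su; have [mR mI] := mu.
have e2 : 0 < e / 2 by rewrite divr_gt0.
have [uR uI] : (sqint dx (fun x => complex.Re (u x)) < +oo)%E /\
    (sqint dx (fun x => complex.Im (u x)) < +oo)%E.
  move: u2; rewrite nsqE// => u2.
  by split; apply: le_lt_trans u2; rewrite ?leeDl ?leeDr ?sqint_ge0.
have [g1 [s1 g1s] u1] := sqint_real_trig mR uR e2.
have [g2 [s2 g2s] u2'] := sqint_real_trig mI uI e2.
pose s := s1 ++ [seq (q.1, (0 +i* 1)%C * q.2) | q <- s2].
have sE x : trigpoly s x = (g1 x +i* g2 x)%C.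
  rewrite /trigpoly big_cat big_map /=.
  under [X in _ + X]eq_bigr do rewrite -mulrA.
  rewrite -mulr_sumr -!/(trigpoly _ x) -g1s -g2s.
  by apply/eqP; rewrite eq_complex /=; apply/andP; split; apply/eqP; ring.
have [A [c [uA sA]]] := trigpoly_trigsum s.
exists A, c; split => //.
have [muA _] := square_integrable_sub_trigsum c A su.
rewrite nsqE// (splitr e) EFinD -sA; apply: leeD.
  apply: le_trans u1; rewrite le_eqVlt; apply/orP; left; apply/eqP.
  by congr (sqint _ _); apply/funext => x; rewrite sE; case: (u x).
apply: le_trans u2'; rewrite le_eqVlt; apply/orP; left; apply/eqP.
by congr (sqint _ _); apply/funext => x; rewrite sE; case: (u x).
Qed.

(* The error of a trigonometric approximation only decreases when the frequencies
   outside the spectrum of u are discarded. *)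
Lemma trigsum_dense_spectrum u (S : set Z) (e : R) : square_integrable u ->
  (forall k, ~ S k -> fourier_coef u k = 0) -> 0 < e ->
  exists A c, [/\ uniq A, [set` A] `<=` S &
    (nsq (fun x => u x - trigsum c A x)%R <= e%:E)%E].
Proof.
move=> su uS e0; have [A [c [uA Ae]]] := trigsum_dense su e0.
pose A1 := [seq k <- A | `[< S k >]]; pose A2 := [seq k <- A | ~~ `[< S k >]].
exists A1, c; split; first exact: filter_uniq.
  by move=> k /=; rewrite mem_filter => /andP[/asboolP].
apply: le_trans Ae.
set p := trigsum c A1; set r := trigsum c A2.
have Ar x : trigsum c A x = p x + r x.
  rewrite /p /r /trigsum -big_cat /=; apply: perm_big.
  by rewrite perm_sym; apply/permPl; exact: perm_filterC.
have sy := square_integrable_sub_trigsum c A1 su.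
have syr := square_integrable_sub_trigsum c A su.
have sr := tame_square_integrable (trigsum_tame c A2).
have iy := square_integrable_sqnorm sy.
have iyr := square_integrable_sqnorm syr.
have ir := square_integrable_sqnorm sr.
(* The frequencies of r are outside [S], where the coefficients of u vanish, and differ from those
   of p. So u - p and r are orthogonal, and Pythagoras applies. *)
have [iW W0] : mean0 (fun x => (u x - p x) * (r x)^*%C).
  rewrite (_ : (fun x => _) = (fun x => \sum_(l <- A2) (c l)^*%C * (u x * (expi l x)^*%C)
      + \sum_(k <- A1) \sum_(l <- A2) (- (c k * (c l)^*%C)) * expi (k - l) x)).
    apply: mean0D; apply: mean0_sum.
      move=> l; rewrite mem_filter => /andP[/asboolPn lS _].
      by apply: mean0_mul_expi => //; exact: uS.
    move=> k; rewrite mem_filter => /andP[kS _]; apply: mean0_sum => l.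
    rewrite mem_filter => /andP[lS _]; apply: mean0_expi; rewrite subr_eq0.
    by apply: contraTneq kS => ->.
  apply/funext => x; rewrite mulrBl; congr (_ + _).
    rewrite /r /trigsum rmorph_sum/= mulr_sumr; apply: eq_bigr => l _.
    have -> : (c l * expi l x)^*%C = (c l)^*%C * (expi l x)^*%C by exact: rmorphM.
    by rewrite mulrCA.
  rewrite /p /r /trigsum rmorph_sum/= mulr_suml -sumrN; apply: eq_bigr => k _.
  rewrite mulr_sumr -sumrN; apply: eq_bigr => l _.
  have -> : (c l * expi l x)^*%C = (c l)^*%C * expi (- l) x.
    by rewrite -conj_expi; exact: rmorphM.
  by rewrite expiD; ring.
have EFin_int f : integrable f -> (\int[dx]_x (f x)%:E = (\int[dx]_x f x)%:E)%E.
  by move=> jf; rewrite /Rintegral fineK//; exact: integrable_fin_num.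
rewrite /nsq !EFin_int// lee_fin.
have E x : sqnorm (u x - trigsum c A x) = sqnorm (u x - p x) + sqnorm (r x)
    + (-2) * complex.Re ((u x - p x) * (r x)^*%C).
  rewrite Ar opprD addrA; case: (u x - p x) (r x) => [a b] [a' b'].
  by rewrite /sqnorm /=; ring.
have -> : \int[dx]_x sqnorm (u x - trigsum c A x) =
    \int[dx]_x sqnorm (u x - p x) + \int[dx]_x sqnorm (r x).
  under eq_Rintegral do rewrite E.
  rewrite RintegralD//=; last 2 first.
  - by apply: eq_integrable (integrableD measurableT iy ir).
  - by apply: eq_integrable (integrableZl measurableT (-2) iW).
  by rewrite RintegralD// RintegralZl// W0 mulr0 addr0.
by rewrite lerDl; apply: Rintegral_ge0 => x _; exact: sqnorm_ge0.
Qed.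

End projection.

(** * Absolute continuity *)

Section test_functions.
Context {R : realType} {d : nat}.
Local Notation T := (torus R d).
Local Notation dx := (lebesgue_torus R d).
Variable mu : {measure set T -> \bar R}.
Hypothesis mu_fin : (mu setT < +oo)%E.

Lemma indic_approx (E : set T) (e : R) : measurable E -> 0 < e ->
  exists a, [/\ trig_limit a,
    (sqint dx (fun x => \1_E x - a x)%R <= e%:E)%E &
    (sqint mu (fun x => \1_E x - a x)%R <= e%:E)%E].
Proof.
move=> mE e0; pose m := measure_add dx mu.
have m_fin : (m setT < +oo)%E by rewrite /m measure_addE lte_add_pinfty// lebesgue_torus_lty.
have [_ /(_ _ e0)[a la]] := L2_approximable_indic m_fin mE.
have ma := trig_limit_measurable la.
rewrite /sqint ge0_integral_measure_add//; last 2 first.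
- by move=> x _; rewrite lee_fin sqr_ge0.
- by apply: measurable_sqr; apply: measurable_funB => //; exact: measurable_indic.
move=> H; exists a; split => //; apply: le_trans H; rewrite ?leeDl ?leeDr//; exact: sqint_ge0.
Qed.

(* If a is L^2-close to the indicator function 1_E, then a^2 has a small dx-integral
   but a large mu-integral, because 1_E <= 2 a^2 + 2 (1_E - a)^2. Minima of finitely
   many such functions inherit this and form a decreasing sequence. *)
Lemma null_set_test_functions (E : set T) (eta : R) : measurable E -> 0 < eta ->
  dx E = 0%E -> mu E = eta%:E ->
  exists b : nat -> T -> R, forall i, [/\ trig_limit (b i),
    forall x, 0 <= b i x, forall x, b i.+1 x <= b i x,
    (\int[dx]_x (b i x)%:E <= (2^-1 ^+ i)%:E)%E &
    ((eta / 4)%:E <= \int[mu]_x (b i x)%:E)%E].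
Proof.
move=> mE eta0 dxE muE.
(* The errors [e j] sum to [kap]. The bound 1 gives the dx-integral at most 2^-i; the bound eta / 8
   gives eta <= 2 B + eta / 4 for the mu-integral B of [b i], which exceeds the required B >= eta /
   4. *)
pose kap := Num.min 1 (eta / 8).
have kap0 : 0 < kap by rewrite lt_min ltr01 divr_gt0.
have h0 n : 0 < 2^-1 ^+ n :> R by rewrite exprn_gt0// invr_gt0.
pose e j := kap * 2^-1 ^+ j.+1.
have e0 j : 0 < e j by rewrite mulr_gt0.
have /choice[a aP] : forall j, exists a, [/\ trig_limit a,
    (sqint dx (fun x => \1_E x - a x)%R <= (e j)%:E)%E &
    (sqint mu (fun x => \1_E x - a x)%R <= (e j)%:E)%E].
  by move=> j; exact: indic_approx.
have la j : trig_limit (a j) by have [] := aP j.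
have lsq j : trig_limit (fun x => a j x ^+ 2) by apply: trig_limitM.
have mB j : measurable_fun setT (fun x => \1_E x - a j x).
  by apply: measurable_funB; [exact: measurable_indic|exact: trig_limit_measurable].
pose b := fix b i x := if i is i'.+1 then Num.min (b i' x) (a i x ^+ 2) else a 0%N x ^+ 2.
(* The sum of the squared errors up to i dominates the error belonging to whichever a_j^2 attains
   the minimum [b i]. *)
pose q := fix q i x : R := if i is i'.+1 then q i' x + (\1_E x - a i x) ^+ 2
  else (\1_E x - a 0%N x) ^+ 2.
have lb i : trig_limit (b i).
  by elim: i => [|i IH] /=; [exact: lsq|exact: trig_limit_min].
have b0 i x : 0 <= b i x.
  by elim: i => [|i IH] /=; rewrite ?le_min ?IH ?sqr_ge0.
have q0 i x : 0 <= q i x.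
  by elim: i => [|i IH] /=; rewrite ?addr_ge0 ?sqr_ge0.
have mq i : measurable_fun setT (q i).
  by elim: i => [|i IH] /=; [|apply: measurable_funD => //]; exact: measurable_funX.
have mb i : measurable_fun setT (b i) by exact: trig_limit_measurable.
have bq i x : \1_E x <= 2 * b i x + 2 * q i x.
  have key j : \1_E x <= 2 * a j x ^+ 2 + 2 * (\1_E x - a j x) ^+ 2.
    have I2 : (\1_E x : R) ^+ 2 = \1_E x.
      by rewrite indicE; case: (x \in E); rewrite /= ?expr1n ?expr0n.
    rewrite -{1}I2; have := sqr_ge0 (2 * a j x - \1_E x); nra.
  elim: i => [|i IH] /=; first exact: key.
  have := key i.+1; have := q0 i x; have := sqr_ge0 (\1_E x - a i.+1 x).
  by case: (leP (b i x) (a i.+1 x ^+ 2)) => _; lra.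
have intq i : (\int[mu]_x (q i x)%:E <= (kap * (1 - 2^-1 ^+ i.+1))%:E)%E.
  elim: i => [|i IH] /=.
    have [_ _] := aP 0%N; rewrite /sqint /e => /le_trans; apply.
    by rewrite lee_fin expr1; lra.
  under eq_integral do rewrite EFinD.
  rewrite ge0_integralD//; last 4 first.
  - by move=> x _; rewrite lee_fin.
  - by apply/measurable_EFinP; exact: mq.
  - by move=> x _; rewrite lee_fin sqr_ge0.
  - exact: measurable_sqr.
  have [_ _] := aP i.+1; rewrite /sqint => /(leeD IH)/le_trans; apply.
  rewrite -EFinD lee_fin /e [2^-1 ^+ i.+2]exprS.
  by move: (2^-1 ^+ i.+1) => t; lra.
exists b => i; split => //.
- by move=> x /=; rewrite ge_min lexx.
- apply: (@le_trans _ _ (\int[dx]_x (a i x ^+ 2)%:E)%E).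
    apply: ge0_le_integral => //.
    + by move=> x _; rewrite lee_fin.
    + exact/measurable_EFinP.
    + by apply: measurable_sqr; exact: trig_limit_measurable.
    + by move=> x _; rewrite lee_fin; case: i => [|i] //=; rewrite ge_min lexx orbT.
  apply: (@le_trans _ _ (e i)%:E).
    have [_ + _] := aP i; rewrite /sqint; apply: le_trans.
    rewrite le_eqVlt; apply/orP; left; apply/eqP.
    (* Since [E] is dx-null, a^2 and (1_E - a)^2 agree almost everywhere. *)
    apply: ae_eq_integral => //.
    + by apply: measurable_sqr; exact: trig_limit_measurable.
    + exact: measurable_sqr.
    + exists E; split => //= x /=; apply: contra_notP => xE _.
      by rewrite indicE memNset// sub0r sqrrN.
  rewrite lee_fin /e exprS mulrA ler_piMl ?(ltW (h0 _))//.
  have : kap <= 1 by rewrite ge_min lexx.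
  by have := kap0; lra.
have : (eta%:E <= 2%:E * \int[mu]_x (b i x)%:E + 2%:E * \int[mu]_x (q i x)%:E)%E.
  rewrite -!ge0_integralZl//; last 4 first.
  - exact/measurable_EFinP.
  - by move=> x _; rewrite lee_fin.
  - exact/measurable_EFinP.
  - by move=> x _; rewrite lee_fin.
  have m2 (g : T -> R) : measurable_fun setT g ->
    measurable_fun setT (fun x : T => (2%:E * (g x)%:E)%E : \bar R).
    by move=> mg; apply: emeasurable_funM; [exact: measurable_cst|exact/measurable_EFinP].
  rewrite -ge0_integralD//; last 4 first.
  - by move=> x _; rewrite -EFinM lee_fin mulr_ge0.
  - exact: m2.
  - by move=> x _; rewrite -EFinM lee_fin mulr_ge0.
  - exact: m2.
  rewrite -muE -(setIT E) -integral_indic//; apply: ge0_le_integral => //.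
  + by apply/measurable_EFinP; exact: measurable_indic.
  + by apply: emeasurable_funD; exact: m2.
  + by move=> x _; rewrite -!EFinM -EFinD lee_fin.
have := intq i; have := h0 i.+1.
have kap8 : kap <= eta / 8 by rewrite ge_min lexx orbT.
have Iq0 : (0 <= \int[mu]_x (q i x)%:E)%E by apply: integral_ge0 => x _; rewrite lee_fin.
have Ib0 : (0 <= \int[mu]_x (b i x)%:E)%E by apply: integral_ge0 => x _; rewrite lee_fin.
case: (\int[mu]_x (b i x)%:E)%E Ib0 => [B|//|//] _; last by rewrite leey.
case: (\int[mu]_x (q i x)%:E)%E Iq0 => [Q|//|//] _.
rewrite -!EFinM -EFinD !lee_fin; move: (2^-1 ^+ i.+1) => t t0 Qt.
by have := mulr_gt0 kap0 t0; nra.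
Qed.

Lemma trig_majorants (b : nat -> T -> R) :
  (forall i, [/\ trig_limit (b i), forall x, 0 <= b i x, forall x, b i.+1 x <= b i x &
    (\int[dx]_x (b i x)%:E <= (2^-1 ^+ i)%:E)%E]) ->
  exists t : nat -> T -> R, [/\ forall i, real_trig (t i),
    forall i x, 0 <= b i x <= t i x, forall i x, t i.+1 x <= t i x &
    \int[dx]_x t n x @[n --> \oo] --> 0].
Proof.
move=> bP; have h0 n : 0 < 2^-1 ^+ n :> R by rewrite exprn_gt0// invr_gt0.
(* The shift 3 2^-i with tolerance 2^-i / 2 places t_i between b_i + (5/2) 2^-i and b_i + (7/2)
   2^-i. The sequence decreases since (7/2) 2^-(i+1) <= (5/2) 2^-i, and its integrals still tend to
   0. *)
have /choice[t tP] : forall i, exists t, real_trig t /\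
    forall x, `|b i x + 3 * 2^-1 ^+ i - t x| <= 2^-1 ^+ i / 2.
  move=> i; have [lb _ _ _] := bP i.
  have [g tg gP] := trig_limitD lb (trig_limit_cst (3 * 2^-1 ^+ i)) (divr_gt0 (h0 i) (ltr0n _ 2)).
  by exists g.
have tb i x : b i x + 5 / 2 * 2^-1 ^+ i <= t i x <= b i x + 7 / 2 * 2^-1 ^+ i.
  have [_ /(_ x)] := tP i; rewrite ler_norml => /andP[t1 t2].
  by apply/andP; split; lra.
exists t; split.
- by move=> i; have [] := tP i.
- move=> i x; have [_ -> _ _] := bP i; have /andP[+ _] := tb i x.
  by have := h0 i; lra.
- move=> i x; have /andP[+ _] := tb i x; have /andP[_] := tb i.+1 x.
  have [_ _ /(_ x) bd _] := bP i; rewrite exprS.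
  by have := h0 i; lra.
set V : R := (2 * pi) ^+ d.
have int_cont f : trig_limit f -> dx.-integrable setT (EFin \o f).
  move=> lf; apply: continuous_bounded_integrable; first exact: trig_limit_continuous.
  by have [B _ fB] := trig_limit_bounded lf; exists B.
apply: (@squeeze_cvgr _ _ _ _ (fun=> 0) (fun n => (1 + 7 / 2 * V) * 2^-1 ^+ n)).
- apply: nearW => n; have [lb b0 _ ib] := bP n; have [rt _] := tP n.
  have lt := real_trig_limit rt.
  apply/andP; split.
    apply: Rintegral_ge0 => x _; have /andP[+ _] := tb n x.
    by have := b0 x; have := h0 n; lra.
  apply: (@le_trans _ _ (\int[dx]_x (b n x + 7 / 2 * 2^-1 ^+ n))).
    apply: le_Rintegral => //; [exact: int_cont| |].
      by apply: int_cont; apply: trig_limitD => //; exact: trig_limit_cst.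
    by move=> x _; have /andP[] := tb n x.
  rewrite RintegralD//; [|exact: int_cont|by apply: int_cont; exact: trig_limit_cst].
  rewrite Rintegral_cst// (_ : fine _ = V); last exact: (congr1 fine lebesgue_torusT).
  have : \int[dx]_x b n x <= 2^-1 ^+ n.
    rewrite -lee_fin /Rintegral fineK//; exact: integrable_fin_num (int_cont _ lb).
  by lra.
- exact: cvg_cst.
- rewrite -(mulr0 (1 + 7 / 2 * V)); apply: cvgM; first exact: cvg_cst.
  by apply: cvg_expr; rewrite ger0_norm ?invr_ge0// invf_lt1// ltr1n.
Qed.

End test_functions.

Section fourier_linearity.
Context {R : realType} {d : nat}.
Local Notation T := (torus R d).
Local Notation dx := (lebesgue_torus R d).
Implicit Types (u v : T -> R[i]).

Lemma square_integrableZ (c : R[i]) u : square_integrable u ->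
  square_integrable (fun x => c * u x).
Proof.
move=> [[mR mI] u2].
have mc : measurable_cfun (fun x => c * u x).
  split.
    apply: eq_measurable_fun (measurable_funB
      (measurable_funM (measurable_cst (complex.Re c)) mR)
      (measurable_funM (measurable_cst (complex.Im c)) mI)) => x _ /=.
    by case: (c) (u x) => [? ?] [? ?].
  apply: eq_measurable_fun (measurable_funD
    (measurable_funM (measurable_cst (complex.Re c)) mI)
    (measurable_funM (measurable_cst (complex.Im c)) mR)) => x _ /=.
  by case: (c) (u x) => [? ?] [? ?].
split => //; rewrite /nsq; under eq_integral do rewrite sqnormM EFinM.
rewrite ge0_integralZl//.
- by rewrite lte_mul_pinfty// lee_fin sqnorm_ge0.
- by apply/measurable_EFinP; exact: measurable_sqnorm.
- by move=> x _; rewrite lee_fin sqnorm_ge0.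
- by rewrite lee_fin sqnorm_ge0.
Qed.

Lemma fourier_coefZ (c : R[i]) u k : square_integrable u ->
  fourier_coef (fun x => c * u x) k = c * fourier_coef u k.
Proof.
move=> su; rewrite /fourier_coef mulrCA; congr (_ * _).
have [iR iI] := square_integrable_mul_expi k su.
have iZ a f : dx.-integrable setT (EFin \o f) ->
    dx.-integrable setT (EFin \o (fun x => a * f x)).
  by move=> jf; apply: eq_integrable (integrableZl measurableT a jf).
rewrite /cintegral; apply/eqP; rewrite eq_complex; apply/andP; split; apply/eqP.
  transitivity (\int[dx]_x (complex.Re c * complex.Re (u x * (expi k x)^*%C)
      - complex.Im c * complex.Im (u x * (expi k x)^*%C))).
    by apply: eq_Rintegral => x _; rewrite -mulrA; case: (c) (u x * _) => [? ?] [? ?].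
  rewrite RintegralB//; [|exact: iZ|exact: iZ]; rewrite !RintegralZl//.
  by case: (c).
transitivity (\int[dx]_x (complex.Re c * complex.Im (u x * (expi k x)^*%C)
    + complex.Im c * complex.Re (u x * (expi k x)^*%C))).
  by apply: eq_Rintegral => x _; rewrite -mulrA; case: (c) (u x * _) => [? ?] [? ?].
rewrite RintegralD//; [|exact: iZ|exact: iZ]; rewrite !RintegralZl//.
by case: (c).
Qed.

Lemma fourier_coefD u v k : square_integrable u -> square_integrable v ->
  fourier_coef (fun x => u x + v x) k = fourier_coef u k + fourier_coef v k.
Proof.
move=> su sv; rewrite /fourier_coef -mulrDr; congr (_ * _).
have [uR uI] := square_integrable_mul_expi k su.
have [vR vI] := square_integrable_mul_expi k sv.
rewrite /cintegral; apply/eqP; rewrite eq_complex /=; apply/andP; split; apply/eqP.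
  rewrite -RintegralD//; apply: eq_Rintegral => x _; rewrite mulrDl.
  by case: (u x * _) (v x * _) => [? ?] [? ?].
rewrite -RintegralD//; apply: eq_Rintegral => x _; rewrite mulrDl.
by case: (u x * _) (v x * _) => [? ?] [? ?].
Qed.

End fourier_linearity.

Lemma limn_esup_lt (R : realType) (f : nat -> \bar R) (e : \bar R) :
  (limn_esup f < e)%E -> exists N, forall n, (N <= n)%N -> (f n < e)%E.
Proof.
rewrite limn_esup_lim (cvg_lim _ (@cvg_esups_inf R f))// => /ereal_inf_lt[_ [N _ <-] fN].
exists N => n Nn; apply: le_lt_trans fN; apply: ereal_sup_ubound.
by exists n.
Qed.

(** * From trigonometric sums to eigenfunctions *)

Section main_estimate.
Context {R : realType} {d : nat}.
Local Notation T := (torus R d).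
Local Notation dx := (lebesgue_torus R d).

(** With p the trigonometric sum, t |u|^2 <= 2 t |p|^2 + 2 t |u - p|^2. The first term integrates to
    at most 2 eta times the integral of |p|^2, itself at most 2 + 2 e; the second to at most 2 B
    e. *)
Lemma trig_form_nsq (t : T -> R) (u : T -> R[i]) (c : 'rV[int]_d -> R[i]) A (B eta e : R) :
  real_trig t -> (forall x, 0 <= t x <= B) -> square_integrable u -> nsq u = 1%E ->
  0 <= eta -> trig_form t c A <= eta * trig_form (fun=> 1) c A ->
  (nsq (fun x => u x - trigsum c A x)%R <= e%:E)%E ->
  (\int[dx]_x (t x * sqnorm (u x))%:E <= (4 * eta * (1 + e) + 2 * B * e)%:E)%E.
Proof.
move=> tt tB su u1 eta0 ft ue; set p := trigsum c A.
have tp := trigsum_tame c A; have [mp _] := tame_square_integrable tp.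
have sup := square_integrable_sub_trigsum c A su; have [mup _] := sup; have [mu _] := su.
have mt : measurable_fun setT t by apply: continuous_measurable_torus; exact: real_trig_continuous.
have msq v : measurable_cfun v -> measurable_fun setT (fun x => (t x * sqnorm (v x))%:E).
  by move=> mv; apply/measurable_EFinP/measurable_funM => //; exact: measurable_sqnorm.
have t0 x : 0 <= t x by have /andP[] := tB x.
have p0 v : forall x, [set: T] x -> (0 <= (t x * sqnorm (v x))%:E)%E.
  by move=> x _; rewrite lee_fin mulr_ge0// sqnorm_ge0.
have EFin_int f : dx.-integrable setT (EFin \o f) -> (\int[dx]_x (f x)%:E = (\int[dx]_x f x)%:E)%E.
  by move=> jf; rewrite /Rintegral fineK//; exact: integrable_fin_num.
have tr1 : real_trig (fun _ : T => 1 : R) by exact: real_trig_cst.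
have f1 : ((trig_form (fun=> 1) c A)%:E <= 2%:E + 2%:E * e%:E)%E.
  rewrite -(EFin_int _ (trig_form_integrable tr1 tp)).
  have -> : (\int[dx]_x (1 * sqnorm (trigsum c A x))%:E = nsq (fun x => u x + (p x - u x))%R)%E.
    by apply: eq_integral => x _; rewrite mul1r addrC subrK.
  have mpu : measurable_cfun (fun x => p x - u x).
    have [] := square_integrableD (tame_square_integrable tp) (square_integrableZ (-1) su).
    by under eq_fun do rewrite mulN1r.
  apply: (le_trans (nsqD mu mpu)); rewrite u1 mule1 leeD2l//; apply: lee_wpmul2l => //.
  apply: le_trans ue; rewrite le_eqVlt; apply/orP; left; apply/eqP.
  apply: eq_integral => x _; rewrite -opprB; case: (u x - p x) => a b.
  by rewrite /sqnorm /= !sqrrN.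
apply: (@le_trans _ _ (2%:E * \int[dx]_x (t x * sqnorm (p x))%:E +
    2%:E * \int[dx]_x (t x * sqnorm (u x - p x))%:E)%E).
  rewrite -!ge0_integralZl//; [|exact: msq|exact: (p0 (fun x => u x - p x))|exact: msq|exact: p0].
  rewrite -ge0_integralD//; last 4 first.
  - by move=> x xT; rewrite mule_ge0//; exact: p0.
  - by apply: emeasurable_funM; [exact: measurable_cst|exact: msq].
  - by move=> x xT; rewrite mule_ge0//; exact: (p0 (fun x => u x - p x)).
  - by apply: emeasurable_funM; [exact: measurable_cst|exact: msq].
  apply: ge0_le_integral => //; [exact: p0|exact: msq| |].
    apply: emeasurable_funD; apply: emeasurable_funM; try exact: measurable_cst; exact: msq.
  move=> x _; rewrite -!EFinM -EFinD lee_fin.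
  have := sqnormD_le (p x) (u x - p x); rewrite addrC subrK => /(ler_wpM2l (t0 x)).
  by lra.
rewrite [X in (2%:E * X + _)%E](_ : _ = (trig_form t c A)%:E); last first.
  exact: (EFin_int _ (trig_form_integrable tt tp)).
have B0 : 0 <= B by have /andP[] := tB (\pi_(T)%qT 0); exact: le_trans.
have h2 : (\int[dx]_x (t x * sqnorm (u x - p x))%:E <= (B * e)%:E)%E.
  apply: (@le_trans _ _ (B%:E * nsq (fun x => u x - p x)%R)%E).
    rewrite /nsq -ge0_integralZl//; last 2 first.
    - by apply/measurable_EFinP; exact: measurable_sqnorm.
    - by move=> x _; rewrite lee_fin sqnorm_ge0.
    apply: ge0_le_integral => //.
    - exact: (p0 (fun x => u x - p x)).
    - exact: msq.
    - apply: emeasurable_funM; first exact: measurable_cst.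
      by apply/measurable_EFinP; exact: measurable_sqnorm.
    - move=> x _; rewrite -EFinM lee_fin ler_wpM2r ?sqnorm_ge0//.
      by have /andP[] := tB x.
  by rewrite EFinM; apply: lee_wpmul2l.
apply: (@le_trans _ _ (2%:E * (trig_form t c A)%:E + 2%:E * (B * e)%:E)%E).
  by rewrite leeD2l//; apply: lee_wpmul2l.
rewrite -!EFinM -EFinD lee_fin.
move: f1; rewrite -EFinM -EFinD lee_fin => f1.
have := ler_wpM2l eta0 f1; lra.
Qed.

End main_estimate.

(** A frequency with nonzero coefficient satisfies H(hk) = lambda. As H is real, comparing with the
    real part of the complex eigenvalue is enough to exclude the others. *)
Lemma eigenfunction_spectrum (R : realType) (d : nat) (H : 'rV[R]_d -> R) (h : R)
    (u : torus R d -> R[i]) : eigenfunction H h u ->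
  exists l : R, forall k, H (h *: int_row k) != l -> fourier_coef u k = 0.
Proof.
move=> [_ [lam [u2 _ coef]]]; exists (complex.Re lam) => k Hk.
have := coef k; rewrite fourier_coefZ; last exact: in_L2_square_integrable.
move=> /eqP; rewrite -subr_eq0 -mulrBl mulf_eq0 => /orP[|/eqP//].
rewrite eq_complex /= => /andP[/eqP E _].
by move: E Hk; case: (lam) => a b /= /eqP; rewrite subr_eq0 eq_sym => ->.
Qed.

Theorem corollary1p4 (R : realType) (d : nat)
    (H : 'rV[R]_d -> R)
    (H_smooth : smooth H)
    (H_definite : forall xi : 'rV[R]_d, definite_form (hessian H xi))
    (h : nat -> R)
    (h_gt0 : forall n, 0 < h n)
    (h_cvg0 : h n @[n --> \oo] --> 0)
    (u : nat -> torus R d -> R[i])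
    (u_L2 : forall n, in_L2 (u n))
    (u_normalised : forall n, L2norm (u n) = 1%E)
    (u_oscillating : h_oscillating h u)
    (u_eigen : forall n, eigenfunction H (h n) (u n))
    (phi : nat -> nat)
    (phi_incr : {homo phi : m n / (m < n)%N})
    (mu : {measure set (torus R d) -> \bar R})
    (mu_limit : weak_limit (fun n => u (phi n)) mu) :
  mu `<< lebesgue_torus R d.
Proof.
have u1 n : nsq (u n) = 1%E by rewrite -L2norm_sqr u_normalised poweR_EFin powR1.
have su n : square_integrable (u n) by exact: in_L2_square_integrable.
(* The constant function 1 is an admissible test function on the torus, so no mass is lost in the
   limit. *)
have mu1 : mu setT = 1%E.
  have /mu_limit lim1 : continuous (fun _ : torus R d => 1 : R) by exact: cst_continuous.
  have : (\int[lebesgue_torus R d]_x (1 * modulus (u (phi n) x) ^+ 2)%:E)%E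
     @[n --> \oo] --> (1%E : \bar R).
    rewrite (_ : (fun n => _) = fun=> 1%E); first exact: cvg_cst.
    apply/funext => n; rewrite -(u1 (phi n)); apply: eq_integral => x _.
    by rewrite mul1r modulus_sqr.
  move=> /(cvg_unique (@ereal_hausdorff R) lim1) => <-.
  by rewrite -[LHS]mul1e; apply/esym; exact: integral_cst.
have mu_fin : (mu setT < +oo)%E by rewrite mu1 ltry.
apply/null_content_dominatesP => E mE dxE; apply/eqP/negPn/negP => muE.
have [eta eta0 muEE] : exists2 eta : R, 0 < eta & mu E = eta%:E.
  have : (mu E <= 1)%E by rewrite -mu1; apply: le_measure; rewrite ?inE.
  have : (0 <= mu E)%E by exact: measure_ge0.
  case: (mu E) muE => [r|//|//] r0 r1 _; exists r => //.
  by rewrite lt_neqAle -lee_fin r1 andbT eq_sym.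
have [b bP] := null_set_test_functions mu_fin mE eta0 dxE muEE.
have [t [tt bt tdecr tlim]] : exists t : nat -> torus R d -> R, [/\ forall i, real_trig (t i),
    forall i x, 0 <= b i x <= t i x, forall i x, t i.+1 x <= t i x &
    \int[lebesgue_torus R d]_x t n x @[n --> \oo] --> 0].
  by apply: trig_majorants => i; have [] := bP i.
have t_ge0 i x : 0 <= t i x by have /andP[b0 /(le_trans b0)] := bt i x.
have [B tB] : exists B : R, forall i x, t i x <= B.
  have [B BP] := real_trig_bounded (tt 0%N); exists B => i x.
  apply: (@le_trans _ _ (t 0%N x)); last by apply: le_trans (BP x); exact: ler_norm.
  by elim: i => // i; apply: le_trans.
have B_ge0 : 0 <= B by apply: le_trans (tB 0%N (\pi_(torus R d)%qT 0)).
(* With eta / 256 below, the main estimate is at most 4 (eta / 256) (1 + e) + 2 B e <= eta / 32 +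
   eta / 32, less than the eta / 8 that the limit measure forces. *)
pose e := Num.min 1 (eta / (64 * (B + 1))).
have B1 : 0 < B + 1 by rewrite ltr_wpDl.
have e0 : 0 < e by rewrite lt_min ltr01 divr_gt0// mulr_gt0.
have e1 : e <= 1 by rewrite ge_min lexx.
have eB : 2 * B * e <= eta / 32.
  have : e <= eta / (64 * (B + 1)) by rewrite ge_min lexx orbT.
  rewrite ler_pdivlMr ?mulr_gt0// => H1.
  have := mulr_ge0 (ltW e0) B_ge0; nra.
have e4 : 0 < e / 4 by rewrite divr_gt0.
have [v v_osc v_lim] := u_oscillating.
have [r r1 r_lim] : exists2 r : R, 1 <= r &
    (limn_esup (fun n => L2norm (v r n)) < (e / 4)%:E)%E.
  move: v_lim => /fine_cvgP[fin /cvgrPdist_lt/(_ _ e4) lim].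
  have [M [_ MP]] := filterI fin lim; pose r := Num.max M 1 + 1.
  have Mr : M < r by rewrite /r ltr_pwDr// le_max lexx.
  exists r; first by rewrite /r (@le_trans _ _ (Num.max M 1))// ?lerDl// le_max lexx orbT.
  have [finr] := MP r Mr; rewrite /= sub0r normrN => H1.
  by rewrite -(fineK finr) lte_fin; apply: le_lt_trans H1; exact: ler_norm.
have [N NP] := limn_esup_lt r_lim.
have [c [C [c0 C0 pS]]] := pinched_level_set (H_smooth 2%N) H_definite (r + 1).
have eta256 : 0 < eta / 256 := divr_gt0 eta0 (ltr0n _ 256).
(* The index [i] is fixed before n: [c] and [C] serve every h and every eigenvalue, so weak
   convergence is used only against the fixed function [b i]. *)
have [i iP] := pinched_trigsum_small tt t_ge0 tdecr tlim c0 C0 eta256.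
have [lb b_ge0 _ _ b_mu] := bP i.
have phi_ge n : (n <= phi n)%N.
  by elim: n => // n IH; apply: leq_ltn_trans IH _; exact: phi_incr.
have [n [Nn n_lim]] : exists n, (N <= n)%N /\
    ((eta / 8)%:E < \int[lebesgue_torus R d]_x (b i x * modulus (u (phi n) x) ^+ 2)%:E)%E.
  have lim := mu_limit _ (trig_limit_continuous lb).
  have lt8 : ((eta / 8)%:E < \int[mu]_x (b i x)%:E)%E.
    by apply: lt_le_trans b_mu; rewrite lte_fin; lra.
  have [M _ MP] := lim _ (open_ereal_gt' lt8).
  exists (maxn N M); split; first exact: leq_maxl.
  by apply: MP; exact: leq_maxr.
set m := phi n in n_lim; have Nm : (N <= m)%N by exact: leq_trans (phi_ge n).
have [_ vL2 v_coef] := v_osc r m.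
have sv := in_L2_square_integrable vL2; have [mv _] := sv.
(* The low-frequency part of [u m]: above the cutoff the coefficients of [u m] and [v r m]
   cancel. *)
pose w x := u m x + (-1) * v r m x.
have sw : square_integrable w by apply: square_integrableD => //; exact: square_integrableZ.
have [l lP] := eigenfunction_spectrum (u_eigen m).
set S := [set k | H (h m *: int_row k) = l /\ `|h m *: int_row k : 'rV[R]_d| <= r + 1].
have w_coef k : ~ S k -> fourier_coef w k = 0.
  move=> kS; rewrite /w fourier_coefD//; last exact: square_integrableZ.
  rewrite fourier_coefZ// v_coef -[X in X + _]mul1r mulrA -mulrDl mulN1r.
  rewrite /high_freq indicE.
  have [|kr] := boolP (_ \in _); first by rewrite subrr mul0r.
  rewrite lP ?mulr0//; apply/eqP => Hk; apply: kS; split => //.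
  move: kr; rewrite notin_setE /= => /negP; rewrite -ltNge => kr.
  (* [high_freq] cuts the sum of squares at r, whereas [S] bounds the largest entry: xi_j^2 <= r <=
     (r + 1)^2. *)
  apply: mx_norm_row_le; first by rewrite addr_ge0// (le_trans ler01).
  move=> j; rewrite -(@ler_pXn2r _ 2) ?nnegrE ?addr_ge0// ?(le_trans ler01 r1)//.
  rewrite real_normK ?num_real//.
  apply: (@le_trans _ _ r); last by nra.
  apply: le_trans (ltW kr); rewrite (bigD1 j)//= lerDl.
  by apply: sumr_ge0 => j' _; exact: sqr_ge0.
have [A [p [uA AS wp]]] := trigsum_dense_spectrum sw w_coef e4.
have up : (nsq (fun x => u m x - trigsum p A x)%R <= e%:E)%E.
  have -> : (fun x => u m x - trigsum p A x) = (fun x => (w x - trigsum p A x) + v r m x).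
    by apply/funext => x; rewrite /w mulN1r; ring.
  have [mwp _] := square_integrable_sub_trigsum p A sw.
  apply: (le_trans (nsqD mwp mv)).
  apply: (@le_trans _ _ (2%:E * (e / 4)%:E + 2%:E * (e / 4)%:E)%E); last first.
    by rewrite -!EFinM -EFinD lee_fin; lra.
  apply: leeD; apply: lee_wpmul2l => //.
  (* The oscillation hypothesis bounds the norm itself by e / 4; this number is at most 1, so the
     square obeys the same bound. *)
  have := NP m Nm; rewrite -L2norm_sqr.
  have : (0 <= L2norm (v r m))%E by exact: Lnorm_ge0.
  case: (L2norm _) => [q|//|//]; rewrite lee_fin lte_fin => q0 qe.
  rewrite poweR_EFin lee_fin powR_mulrn// (le_trans _ (ltW qe))// expr2 ler_piMr//.
  by apply: le_trans (ltW qe) _; lra.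
have tB' x : 0 <= t i x <= B by rewrite t_ge0 tB.
have := trig_form_nsq (tt i) tB' (su m) (u1 m) (ltW eta256)
  (iP S (pS (h m) l (h_gt0 m)) A p uA AS) up.
apply/negP; rewrite -ltNge; apply: lt_le_trans (_ : (eta / 8)%:E <= _)%E.
  by rewrite lte_fin; nra.
apply: le_trans (ltW n_lim) _; apply: ge0_le_integral => //.
- by move=> x _; rewrite lee_fin mulr_ge0// sqr_ge0.
- apply/measurable_EFinP; apply: measurable_funM; first exact: trig_limit_measurable.
  rewrite (_ : (fun x => modulus (u m x) ^+ 2) = (fun x => sqnorm (u m x))).
    by apply: measurable_sqnorm; have [] := su m.
  by apply/funext => x; exact: modulus_sqr.
- apply/measurable_EFinP; apply: measurable_funM; last by apply: measurable_sqnorm; have [] := su m.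
  by apply: trig_limit_measurable; exact: real_trig_limit.
- move=> x _; rewrite lee_fin modulus_sqr ler_wpM2r ?sqnorm_ge0//.
  by have /andP[] := bt i x.
Qed.
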